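(* Let $n>m\geq 1$ be integers and let $A$ be a commutative Noetherian $\mathbb{Z}[\frac1p,\zeta_p]$-algebra with $0\neq 1$. Let $(\pi,V)$ be an $A[G_n]$-module and $(\pi',V')$ an $A[G_m]$-module, both of Whittaker type, and suppose that $\pi'$ is not exceptional for $\pi$. Then there exists a unique element $\gamma(\pi\times\pi',\psi)\in A^{\times}$ such that \[ \Big(\sum_{x\in N_m\backslash G_m}W\begin{pmatrix}x & 0\\ 0 & I_{n-m}\end{pmatrix}W'(x)\Big)\gamma(\pi\times \pi',\psi) = \sum_{x\in N_m\backslash G_m}\ \sum_{y\in \mathrm{Mat}_{m, n-m-1}(\mathbb{F}_q)}W\begin{pmatrix}0 & 1 &0\\ 0&0 & I_{n-m-1}\\ x &0 & y\end{pmatrix}W'(x) \] for all $W\in \mathcal{W}(V,\psi_A)$ and all $W'\in \mathcal{W}(V',\psi_A^{-1})$. (In the block matrix on the right, the block rows have heights $1,\,n-m-1,\,m$ and the block columns have widths $m,\,1,\,n-m-1$.)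
   Context: Let $p$ be a prime, $q$ a power of $p$, $\mathbb{F}_q$ the field with $q$ elements, $G_n=\mathrm{GL}_n(\mathbb{F}_q)$, and $\zeta_p$ a primitive $p$-th root of unity. Fix a nontrivial homomorphism $\psi:(\mathbb{F}_q,+)\to \mathbb{Z}[\frac1p,\zeta_p]^{\times}$ and let $\psi_A$ be its composite with the structure map to $A^\times$. Let $N_n\subset G_n$ be the upper triangular unipotent matrices; regard $\psi_A$ as a character of $N_n$ via $\psi_A(u)=\psi_A(\sum_{i=1}^{n-1}u_{i,i+1})$. Let $P_n\subset G_n$ be the mirabolic subgroup (matrices with last row $(0,\dots,0,1)$) and $U_n=\{\begin{psmallmatrix}I_{n-1}&y\\0&1\end{psmallmatrix}\}$, on which $\psi_A\begin{psmallmatrix}I_{n-1}&y\\0&1\end{psmallmatrix}=\psi_A(y_{n-1})$; $G_{n-1}$ and $P_{n-1}$ are embedded in $P_n$ in the top left corner. For an $A[P_n]$-module $V$ let $\Phi^-(V)=V/\langle uv-\psi_A(u)v: u\in U_n,v\in V\rangle$ (an $A[P_{n-1}]$-module) and $\Psi^-(V)=V/\langle uv-v:u\in U_n, v\in V\rangle$ (an $A[G_{n-1}]$-module). For $1\le k\le n$ the $k$-th derivative is $V^{(k)}=\Psi^-(\Phi^-)^{k-1}(V)$, an $A[G_{n-k}]$-module; for an $A[G_n]$-module it is the derivative of its restriction to $P_n$, and $V^{(0)}=V$. The top derivative $V^{(n)}$ is isomorphic to the $(N_n,\psi_A)$-coinvariants of $V$. An $A[G_n]$-module $V$ is of Whittaker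 type if $V^{(n)}$ is a free $A$-module of rank one. For such $V$, choosing a generator $\lambda$ of $\mathrm{Hom}_A(V^{(n)},A)$ gives a map $V\to \mathrm{Ind}_{N_n}^{G_n}\psi_A=\{f:G_n\to A: f(ug)=\psi_A(u)f(g)\}$, $v\mapsto (g\mapsto \lambda(\overline{gv}))$; its image $\mathcal{W}(V,\psi_A)$ (independent of $\lambda$) is the Whittaker model. The same constructions with $\psi_A^{-1}$ in place of $\psi_A$ give derivatives with respect to $\psi_A^{-1}$ and the Whittaker model $\mathcal{W}(V',\psi_A^{-1})\subset\mathrm{Ind}_{N_m}^{G_m}\psi_A^{-1}$ (the $(N_m,\psi_A^{-1})$-coinvariants of a Whittaker type module are also free of rank one). The module $\pi'$ is exceptional for $\pi$ if there is $t\in\{1,\dots,m\}$ with $\mathrm{Hom}_{A[G_t]}\big(\mathcal{W}(V,\psi_A)^{(n-t)}\otimes_A\mathcal{W}(V',\psi_A^{-1})^{(m-t)},\mathbf{1}\big)\neq 0$, i.e. there is a nonzero $G_t$-invariant $A$-bilinear form on these derivatives ($G_t$ acting diagonally; derivatives of $\mathcal{W}(V',\psi_A^{-1})$ taken with respect to $\psi_A^{-1}$). *)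

(* Defs.v *)
From HB Require Import structures.
From mathcomp Require Import all_boot all_order all_algebra.
Set Implicit Arguments. Unset Strict Implicit. Unset Printing Implicit Defensive.
Import Order.TTheory GRing.Theory.
Local Open Scope ring_scope.

Section Defs.
Variable F : finFieldType.
Variable A : comUnitRingType.

Definition is_ideal (I : A -> Prop) : Prop :=
  [/\ I 0, (forall x y, I x -> I y -> I (x + y)) & (forall a x, I x -> I (a * x))].

Definition noetherian : Prop :=
  forall I : A -> Prop, is_ideal I ->
    exists (r : nat) (g : 'I_r -> A),
      forall x, I x <-> exists c : 'I_r -> A, x = \sum_(i < r) c i * g i.

(* The additive character psi_A = (structure map) o psi, where
   psi(x) = zeta_p ^ lam(x) for a nonzero additive lam : F -> F_p
   (every nontrivial hom (F_q,+) -> Z[1/p,zeta_p]^x has this form),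
   and zeta = image of zeta_p in A. *)
Definition psiA (p : nat) (zeta : A) (lam : F -> 'F_p) (x : F) : A :=
  zeta ^+ (nat_of_ord (lam x)).

(* An A[G_n]-module: an A-module V with an action of the invertible
   n x n matrices over F by A-linear maps (rho is irrelevant on
   singular matrices). *)
Definition is_rep (n : nat) (V : lmodType A) (rho : 'M[F]_n -> V -> V) : Prop :=
  [/\ forall g, g \in unitmx -> forall (a : A) (u v : V),
        rho g (a *: u + v) = a *: rho g u + rho g v,
      forall v, rho 1%:M v = v &
      forall g h, g \in unitmx -> h \in unitmx -> forall v,
        rho (g *m h) v = rho g (rho h v)].

Definition inspan (V : lmodType A) (S : V -> Prop) (v : V) : Prop :=
  exists (r : nat) (a : 'I_r -> A) (w : 'I_r -> V),
    (forall i, S (w i)) /\ v = \sum_(i < r) a i *: w i.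

Definition unip (n : nat) (u : 'M[F]_n) : bool :=
  [forall i : 'I_n, forall j : 'I_n,
     ((j < i)%N ==> (u i j == 0)) && ((i == j) ==> (u i j == 1))].

Definition psiN (n : nat) (psi : F -> A) (u : 'M[F]_n) : A :=
  psi (\sum_(i : 'I_n) \sum_(j : 'I_n | val j == (val i).+1) u i j).

(* (N_n, psi)-coinvariants V^{(n)} of V, via their kernel *)
Definition whit_gens (n : nat) (V : lmodType A) (rho : 'M[F]_n -> V -> V)
  (psi : F -> A) (z : V) : Prop :=
  exists (u : 'M[F]_n) (w : V), unip u /\ z = rho u w - psiN psi u *: w.

(* l : V -> A is (the composite of the projection V -> V^{(n)} with)
   an isomorphism V^{(n)} ~ A, i.e. a generator of Hom_A(V^{(n)},A)
   when V^{(n)} is free of rank one: l is A-linear, onto, and its kernel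
   is exactly the kernel of V -> V^{(n)}. *)
Definition whit_gen (n : nat) (V : lmodType A) (rho : 'M[F]_n -> V -> V)
  (psi : F -> A) (l : V -> A) : Prop :=
  [/\ forall (a : A) (u v : V), l (a *: u + v) = a * l u + l v,
      forall a : A, exists v, l v = a &
      forall v, l v = 0 <-> inspan (whit_gens rho psi) v].

Definition whittaker_type (n : nat) (V : lmodType A)
  (rho : 'M[F]_n -> V -> V) (psi : F -> A) : Prop :=
  exists l, whit_gen rho psi l.

(* The Whittaker model W(V,psi) (as functions on G_n; values on
   singular matrices are irrelevant). *)
Definition whittaker_model (n : nat) (V : lmodType A)
  (rho : 'M[F]_n -> V -> V) (psi : F -> A) (W : 'M[F]_n -> A) : Prop :=
  exists l, whit_gen rho psi l /\
    exists v, forall g, g \in unitmx -> W g = l (rho g v).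

(* U_{c+1} (0-indexed column c): identity except column c above the diagonal *)
Definition Ucol (n : nat) (c : 'I_n) (u : 'M[F]_n) : bool :=
  [forall i : 'I_n, forall j : 'I_n,
     if i == j then u i j == 1
     else if (j == c) && (i < c)%N then true else u i j == 0].

(* character used at column c for the k-th derivative:
   trivial on the last step U_{n-k+1} (Psi^-), psi(u_{c-1,c}) otherwise (Phi^-) *)
Definition deriv_char (n k : nat) (psi : F -> A) (c : 'I_n) (u : 'M[F]_n) : A :=
  if val c == (n - k)%N then 1
  else psi (\sum_(i : 'I_n | (val i).+1 == val c) u i c).

(* kernel of V -> V^{(k)} = Psi^-(Phi^-)^{k-1}(V) is the span of these *)
Definition deriv_gens (n k : nat) (V : lmodType A) (rho : 'M[F]_n -> V -> V)
  (psi : F -> A) (z : V) : Prop :=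
  exists (c : 'I_n) (u : 'M[F]_n) (w : V),
    [/\ (n - k <= c)%N, Ucol c u & z = rho u w - deriv_char k psi c u *: w].

(* kernel of V ->> W(V,psi) ->> W(V,psi)^{(k)}, for a generator l:
   v is in it iff W_v lies in the derivative kernel of the model,
   i.e. W_v = W_z for some z in the span of deriv_gens. *)
Definition model_deriv_ker (n k : nat) (V : lmodType A)
  (rho : 'M[F]_n -> V -> V) (psi : F -> A) (l : V -> A) (v : V) : Prop :=
  exists z, inspan (deriv_gens k rho psi) z /\
    forall g, g \in unitmx -> l (rho g v) = l (rho g z).

Definition emb (t n : nat) (g : 'M[F]_t) : 'M[F]_n :=
  \matrix_(i, j) match @insub _ (fun x : nat => (x < t)%N) 'I_t (val i),
                       @insub _ (fun x : nat => (x < t)%N) 'I_t (val j) with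
                 | Some i', Some j' => g i' j'
                 | _, _ => (i == j)%:R
                 end.

(* pi' is exceptional for pi: for some 1 <= t <= m there is a nonzero
   G_t-invariant A-bilinear form on W(V,psi)^{(n-t)} x W(V',psi^-1)^{(m-t)},
   written as a bilinear form on V x V' vanishing on the kernels of
   V ->> W(V,psi)^{(n-t)} and V' ->> W(V',psi^-1)^{(m-t)}. *)
Definition exceptional (n m : nat) (V V' : lmodType A)
  (rho : 'M[F]_n -> V -> V) (rho' : 'M[F]_m -> V' -> V')
  (psi psi' : F -> A) : Prop :=
  exists l l', whit_gen rho psi l /\ whit_gen rho' psi' l' /\
  exists t : nat, [/\ (1 <= t)%N, (t <= m)%N &
  exists B : V -> V' -> A,
    [/\ (forall (a : A) v1 v2 v', B (a *: v1 + v2) v' = a * B v1 v' + B v2 v') /\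
        (forall (a : A) v v1' v2', B v (a *: v1' + v2') = a * B v v1' + B v v2'),
        forall v v', model_deriv_ker (n - t) rho psi l v -> B v v' = 0,
        forall v v', model_deriv_ker (m - t) rho' psi' l' v' -> B v v' = 0,
        forall g : 'M[F]_t, g \in unitmx -> forall v v',
          B (rho (emb n g) v) (rho' (emb m g) v') = B v v' &
        exists v v', B v v' != 0]].

End Defs.

Section Mats.
Variable F : finFieldType.

Definition Nrel (m : nat) : rel 'M[F]_m :=
  fun x y => [exists u : 'M[F]_m, unip u && (y == u *m x)].
Definition GLset (m : nat) : {set 'M[F]_m} := [set x | x \in unitmx].
Definition cosetreps (m : nat) : {set 'M[F]_m} :=
  transversal (equivalence_partition (@Nrel m) (GLset m)) (GLset m).

Lemma bigmat_eqr (m k : nat) : (1 + k + m = m + k.+1)%N.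
Proof. by rewrite addnC add1n. Qed.
Lemma bigmat_eqc (m k : nat) : (m + 1 + k = m + k.+1)%N.
Proof. by rewrite -addnA add1n. Qed.

Definition diagmat (m k : nat) (x : 'M[F]_m) : 'M[F]_(m + k.+1) :=
  block_mx x 0 0 1%:M.

(* [[0,1,0],[0,0,I_{n-m-1}],[x,0,y]] with block rows 1, k, m and block
   columns m, 1, k, where k = n-m-1 *)
Definition bigmat (m k : nat) (x : 'M[F]_m) (y : 'M[F]_(m, k)) : 'M[F]_(m + k.+1) :=
  castmx (bigmat_eqr m k, bigmat_eqc m k)
    (col_mx
       (col_mx (row_mx (row_mx (0 : 'M[F]_(1, m)) (1%:M : 'M[F]_1)) (0 : 'M[F]_(1, k)))
               (row_mx (row_mx (0 : 'M[F]_(k, m)) (0 : 'M[F]_(k, 1))) (1%:M : 'M[F]_k)))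
       (row_mx (row_mx x (0 : 'M[F]_(m, 1))) y)).
End Mats.

(* Main.v *)
(** Both sides of the functional equation are bilinear forms on V x V' that
    only depend on (W_v, W'_v'), are invariant under the diagonal GL_m, and
    transform by psi under the unipotent matrices whose first m+1 columns are
    those of the identity.  Such a form is determined by its value at a pair
    of Bessel vectors, i.e. (N, psi)-eigenvectors v0, v0' with l v0 = l' v0' = 1.
    To see this, expand the form along the Fourier dual of the group U_t of
    column t, for t = m, ..., 1.  The trivial coefficient is a GL_t-invariant
    form on derivatives and vanishes because pi' is not exceptional; the
    nontrivial ones are permuted transitively by GL_t, so the form vanishes as
    soon as the coefficient of psi does, and the latter has the same
    equivariance one step lower.  At t = 0 the form factors through the
    coinvariants.  Hence the right-hand side is gamma times the left-hand one.
    The Bessel function g |-> l (g v0) vanishes on the elements of the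
    mirabolic subgroup that are not unipotent, and likewise for the transposed
    mirabolic, so both forms take the value #|N_m|, a unit: this makes gamma
    unique and invertible. *)

Require Import Defs.
From HB Require Import structures.
From mathcomp Require Import all_boot all_order all_algebra.
From mathcomp Require Import fingroup perm pgroup finfield zify ring.
Import GRing.Theory.
Set Implicit Arguments. Unset Strict Implicit. Unset Printing Implicit Defensive.
Local Open Scope ring_scope.

(** * Matrices *)

Section Matrices.
Variable F : finFieldType.

(* Zero when [n <= t], so that [Uy n y] below is then the identity. *)
Definition erow (n t : nat) : 'rV[F]_n := \row_j (val j == t)%:R.
(** The ambient size [n] is independent of the height of [y], so that one vector [y] can act on both
    V and V'. *)
Definition Uy (n t : nat) (y : 'cV[F]_t) : 'M[F]_n :=
  1%:M + pid_mx t *m y *m erow n t.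
Definition supdiag (n : nat) (u : 'M[F]_n) : F :=
  \sum_(i < n) \sum_(j < n | val j == (val i).+1) u i j.
(** Fixing the first [r] basis vectors, put as a matrix identity so that products and smaller [r]
    follow by associativity. *)
Definition colid (n r : nat) (u : 'M[F]_n) : Prop :=
  u *m pid_mx r = pid_mx r :> 'M_n.

Lemma pid_trK (t n : nat) : (t <= n)%N ->
  (pid_mx t : 'M[F]_(t, n)) *m (pid_mx t : 'M_(n, t)) = 1%:M.
Proof. by move=> le; rewrite mul_pid_mx minnn (minn_idPr le) pid_mx_1. Qed.

Lemma erow_pid (n p t r : nat) : (t < p)%N ->
  erow n t *m (pid_mx r : 'M_(n, p)) = if (t < r)%N && (t < n)%N then erow p t else 0.
Proof.
move=> tp; apply/rowP=> j; rewrite mxE.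
have [tn|nt] := ltnP t n; last first.
  rewrite andbF mxE big1 // => i _; rewrite !mxE (_ : val i == t = false) ?mul0r //.
  by apply/negbTE; rewrite neq_ltn (leq_trans (ltn_ord i) nt).
rewrite andbT (bigD1 (Ordinal tn)) //= big1 ?addr0 => [|i /negbTE ne]; last first.
  by rewrite mxE -(inj_eq val_inj) /= in ne *; rewrite ne mul0r.
rewrite !mxE /= eqxx mul1r; case: ifP => _; rewrite ?andbT ?andbF mxE ?[RHS]mxE //.
by rewrite eq_sym.
Qed.

Lemma erow_pid0 (n t : nat) : erow n t *m (pid_mx t : 'M_(n, t)) = 0.
Proof.
apply/rowP=> j; rewrite !mxE big1 // => i _; rewrite !mxE.
have [->|_] := eqVneq (val i) t; last by rewrite mul0r.
by rewrite ltnn andbF mulr0.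
Qed.

Lemma erow_last (t : nat) (z : 'cV[F]_t.+1) : (erow t.+1 t *m z) 0 0 = z ord_max 0.
Proof.
rewrite mxE (bigD1 ord_max) //= big1 ?addr0 => [|i ne]; first by rewrite mxE eqxx mul1r.
by rewrite mxE (_ : val i == t = false) ?mul0r //; apply: negbTE ne.
Qed.

(** Trades the entrywise case analysis in [emb] for matrix algebra: later identities reduce to
    [pid_trK] and [erow_pid0]. *)
Lemma emb_pid (t n : nat) (g : 'M[F]_t) : (t <= n)%N ->
  emb n g = 1%:M + pid_mx t *m (g - 1%:M) *m pid_mx t.
Proof.
move=> le; apply/matrixP=> i j; rewrite !mxE.
have pidL (M : 'M[F]_t) (k : 'I_t) :
    ((pid_mx t : 'M_(n, t)) *m M) i k
    = if insub (val i) is Some i' then M i' k else 0.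
  rewrite mxE; case: insubP => [i' lt ei|nlt].
    rewrite (bigD1 i') //= big1 ?addr0 => [|h /negbTE ne].
      by rewrite mxE ei eqxx lt mul1r.
    rewrite mxE (_ : val i == val h = false) ?mul0r //.
    by rewrite -ei eq_sym (inj_eq val_inj).
  rewrite big1 // => h _; rewrite mxE.
  by rewrite (negbTE nlt) andbF mul0r.
under eq_bigr => k _ do rewrite pidL.
case: (insubP 'I_t (val i)) => [i' lti ei|nlt]; last first.
  by rewrite big1 ?addr0 // => h _; rewrite mul0r.
case: (insubP 'I_t (val j)) => [j' ltj ej|nltj]; last first.
  rewrite big1 ?addr0 // => k _; rewrite [X in _ * X]mxE.
  rewrite (_ : val k == val j = false) ?mulr0 //.
  by apply: contraNF nltj => /eqP <-; apply: ltn_ord.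
rewrite (bigD1 j') //= big1 ?addr0 => [|k /negbTE ne]; last first.
  rewrite [X in _ * X]mxE (_ : val k == val j = false) ?mulr0 //.
  by rewrite -ej (inj_eq val_inj).
rewrite !mxE ej eqxx -ej ltn_ord mulr1.
have -> : (i == j) = (i' == j') by rewrite -!(inj_eq val_inj) ei ej.
by rewrite addrCA subrr addr0.
Qed.

Lemma emb_id (n : nat) (g : 'M[F]_n) : emb n g = g.
Proof. by rewrite emb_pid // pid_mx_1 mul1mx mulmx1 addrC subrK. Qed.

Lemma emb1 (t n : nat) : (t <= n)%N -> emb n (1%:M : 'M[F]_t) = 1%:M.
Proof. by move=> le; rewrite emb_pid // subrr mulmx0 mul0mx addr0. Qed.

Lemma embM (t n : nat) (g h : 'M[F]_t) : (t <= n)%N ->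
  emb n (g *m h) = emb n g *m emb n h.
Proof.
move=> le; rewrite !emb_pid //; set P := pid_mx t; set Q := pid_mx t.
have QP : Q *m P = 1%:M by apply: pid_trK.
move Ea : (g - 1%:M) => a; move Eb : (h - 1%:M) => b.
have -> : g *m h - 1%:M = a *m b + a + b.
  have -> : g = a + 1%:M by rewrite -Ea subrK.
  have -> : h = b + 1%:M by rewrite -Eb subrK.
  by rewrite mulmxDl mulmxDr mulmx1 mul1mx addrA addrK.
rewrite !(mulmxDr, mulmxDl) !mulmx1 !mul1mx.
rewrite -!mulmxA [Q *m (P *m _)]mulmxA QP mul1mx !mulmxA.
by rewrite -!addrA; congr (_ + _); rewrite addrC -!addrA addrCA.
Qed.

Lemma emb_P (t n : nat) (g : 'M[F]_t) : (t <= n)%N ->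
  emb n g *m (pid_mx t : 'M_(n, t)) = pid_mx t *m g.
Proof.
move=> le; rewrite emb_pid // mulmxDl mul1mx -!mulmxA pid_trK // mulmx1.
by rewrite mulmxBr mulmx1 addrC subrK.
Qed.

Lemma emb_unit (t n : nat) (g : 'M[F]_t) : (t <= n)%N ->
  (emb n g \in unitmx) = (g \in unitmx).
Proof.
move=> le; apply/idP/idP=> [eu|gu].
  have: pid_mx t *m invmx (emb n g) *m pid_mx t *m g = 1%:M.
    by rewrite -mulmxA -emb_P // mulmxA mulmxKV // pid_trK.
  by move=> /mulmx1_unit[].
have := embM g (invmx g) le; rewrite mulmxV // emb1 // => /esym/mulmx1_unit[].
by [].
Qed.

Lemma emb_emb (s t n : nat) (g : 'M[F]_s) : (s <= t)%N -> (t <= n)%N ->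
  emb n (emb t g) = emb n g.
Proof.
move=> st tn; rewrite ![emb n _]emb_pid ?(leq_trans st tn) // (emb_pid g) //.
rewrite addrAC subrr add0r !mulmxA mul_pid_mx -!mulmxA mul_pid_mx.
by rewrite (minn_idPr (leq_trans (geq_minr _ _) st)) (minn_idPl st) (minn_idPr st).
Qed.

Lemma erow_emb (t n : nat) (g : 'M[F]_t) : (t <= n)%N ->
  erow n t *m emb n g = erow n t.
Proof.
by move=> le; rewrite emb_pid // mulmxDr mulmx1 !mulmxA erow_pid0 !mul0mx addr0.
Qed.

Lemma UyD (n t : nat) (y z : 'cV[F]_t) : Uy n (y + z) = Uy n y *m Uy n z.
Proof.
rewrite /Uy mulmxDr !mulmxDl !mul1mx !mulmx1 !mulmxA.
rewrite -[_ *m erow n t *m pid_mx t]mulmxA erow_pid0 mulmx0 !mul0mx addr0.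
by rewrite mulmxDr mulmxDl addrA.
Qed.

Lemma Uy0 (n t : nat) : Uy n (0 : 'cV[F]_t) = 1%:M.
Proof. by rewrite /Uy mulmx0 mul0mx addr0. Qed.

Lemma Uy_unit (n t : nat) (y : 'cV[F]_t) : Uy n y \in unitmx.
Proof. by have := UyD n y (- y); rewrite subrr Uy0 => /esym/mulmx1_unit[]. Qed.

Lemma Uy_conj (n t : nat) (X : 'M[F]_n) (h : 'M[F]_t) (y : 'cV[F]_t) :
  X *m (pid_mx t : 'M_(n, t)) = pid_mx t *m h -> erow n t *m X = erow n t ->
  X *m Uy n y = Uy n (h *m y) *m X.
Proof.
move=> XP eX; rewrite mulmxDr mulmxDl mulmx1 mul1mx !mulmxA XP.
by rewrite -[_ *m erow n t *m X]mulmxA eX.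
Qed.

Lemma emb_Uy (n t : nat) (g : 'M[F]_t) (y : 'cV[F]_t) : (t <= n)%N ->
  emb n g *m Uy n y = Uy n (g *m y) *m emb n g.
Proof. by move=> le; apply: Uy_conj; rewrite ?emb_P ?erow_emb. Qed.

Lemma emb_Uy_small (n t s : nat) (y : 'cV[F]_s) : (s < t)%N -> (t <= n)%N ->
  emb n (Uy t y) = Uy n y.
Proof.
move=> st tn; rewrite emb_pid // /Uy addrAC subrr add0r !mulmxA mul_pid_mx.
by rewrite !(minn_idPr (ltnW st)) -!mulmxA erow_pid ?st ?(leq_trans st tn).
Qed.

(** * Unipotent matrices and the superdiagonal sum *)

Lemma unipP (n : nat) (u : 'M[F]_n) :
  reflect ((forall i j : 'I_n, (j < i)%N -> u i j = 0) /\ forall i, u i i = 1)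
          (unip u).
Proof.
apply: (iffP forallP) => [H|[H0 H1] i].
  split=> [i j lt|i].
    by have /forallP/(_ j)/andP[/implyP/(_ lt)/eqP->] := H i.
  by have /forallP/(_ i)/andP[_ /implyP/(_ (eqxx _))/eqP->] := H i.
apply/forallP=> j; apply/andP; split; apply/implyP.
  by move=> lt; rewrite H0.
by move=> /eqP <-; rewrite H1.
Qed.

Lemma unip1 (n : nat) : unip (1%:M : 'M[F]_n).
Proof.
apply/unipP; split=> [i j lt|i]; rewrite mxE ?eqxx //.
by rewrite -(inj_eq val_inj) gtn_eqF.
Qed.

Lemma unipM (n : nat) (u v : 'M[F]_n) : unip u -> unip v -> unip (u *m v).
Proof.
move=> /unipP[u0 u1] /unipP[v0 v1]; apply/unipP; split=> [i j lt|i].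
  rewrite mxE big1 // => k _; have [ki|ik] := ltnP k i; first by rewrite u0 ?mul0r.
  by rewrite v0 ?mulr0 ?(leq_trans lt).
rewrite mxE (bigD1 i) //= big1 ?addr0 ?u1 ?v1 ?mulr1 // => k ne.
have [ki|ik] := ltnP k i; first by rewrite u0 ?mul0r.
by rewrite v0 ?mulr0 // ltn_neqAle eq_sym ne.
Qed.

Lemma unip_unit (n : nat) (u : 'M[F]_n) : unip u -> u \in unitmx.
Proof.
move=> /unipP[u0 u1]; rewrite -unitmx_tr unitmxE det_trig.
  by rewrite big1 ?unitr1 // => i _; rewrite mxE u1.
by apply/is_trig_mxP => i j lt; rewrite mxE u0.
Qed.

(** Left multiplication by [u] is an injection of the finite set of unipotent matrices into itself,
    hence a bijection, and it reaches the identity. *)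
Lemma unip_invmx (n : nat) (u : 'M[F]_n) : unip u -> unip (invmx u).
Proof.
move=> uu; have injf : injective (fun v : {v : 'M[F]_n | unip v} =>
    exist (fun v => unip v) _ (unipM uu (valP v)) : {v : 'M[F]_n | unip v}).
  move=> v w /(congr1 val) /= /(congr1 (mulmx (invmx u))).
  by rewrite !mulKmx ?unip_unit // => /val_inj.
have [g _ gK] := injF_bij injf.
have /(congr1 val) /= e := gK (exist (fun v => unip v) _ (unip1 n)).
by rewrite -[invmx u]mulmx1 -e mulKmx ?unip_unit // (valP (g _)).
Qed.

(** In entry (i, i+1) of the product only the summation indices i and i+1 contribute, each with a
    diagonal factor 1. *)
Lemma supdiagM (n : nat) (u v : 'M[F]_n) : unip u -> unip v ->
  supdiag (u *m v) = supdiag u + supdiag v.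
Proof.
move=> /unipP[u0 u1] /unipP[v0 v1]; rewrite /supdiag -big_split /=.
apply: eq_bigr => i _; rewrite -big_split /=; apply: eq_bigr => j /eqP ij.
rewrite mxE (bigD1 i) //= (bigD1 j) /=; last first.
  by rewrite -(inj_eq val_inj) /= ij gtn_eqF.
rewrite big1 ?addr0 => [|k /andP[ki kj]].
  by rewrite u1 v1 mul1r mulr1 addrC.
have [lt|ge] := ltnP k i; first by rewrite u0 ?mul0r.
rewrite v0 ?mulr0 // ltn_neqAle eq_sym kj /= ij ltn_neqAle ge andbT.
by rewrite eq_sym.
Qed.

Lemma supdiag1 (n : nat) : supdiag (1%:M : 'M[F]_n) = 0.
Proof.
rewrite /supdiag big1 // => i _; rewrite big1 // => j /eqP ij.
by rewrite mxE -(inj_eq val_inj) /= ij ltn_eqF.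
Qed.

Lemma UyE (n t : nat) (y : 'cV[F]_t) i j :
  Uy n y i j = (i == j)%:R + (val j == t)%:R * oapp (y^~ 0) 0 (insub (val i)).
Proof.
rewrite !mxE big_ord1 mxE mulrC; congr (_ + _); rewrite mxE; congr (_ * _).
case: insubP => [i' lt ei|nlt] /=.
  rewrite (bigD1 i') //= big1 ?addr0 => [|h /negbTE ne].
    by rewrite mxE ei eqxx lt mul1r.
  rewrite mxE (_ : val i == val h = false) ?mul0r //.
  by rewrite -ei eq_sym (inj_eq val_inj).
by rewrite big1 // => h _; rewrite mxE (negbTE nlt) andbF mul0r.
Qed.

Lemma Uy_unip (n t : nat) (y : 'cV[F]_t) : unip (Uy n y).
Proof.
apply/unipP; split=> [i j lt|i]; rewrite UyE.
  rewrite -(inj_eq val_inj) /= gtn_eqF // add0r; case: eqP => [e|]; last by rewrite mul0r.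
  by rewrite insubF ?mulr0 //= -e; apply/negbTE; rewrite -leqNgt ltnW.
rewrite eqxx; case: eqP => [e|]; last by rewrite mul0r addr0.
by rewrite insubF ?mulr0 ?addr0 //= e ltnn.
Qed.

Lemma supdiag_Uy (n t : nat) (y : 'cV[F]_t.+1) : (t.+1 < n)%N ->
  supdiag (Uy n y) = y ord_max 0.
Proof.
move=> lt; rewrite /supdiag (bigD1 (Ordinal (ltnW lt))) //=.
rewrite (bigD1 (Ordinal lt)) //= big1 ?addr0 => [|j /andP[/eqP e /eqP []]]; last first.
  exact: val_inj.
rewrite big1 ?addr0 => [|i ne].
  rewrite UyE /= eqxx mul1r insubT //= -(inj_eq val_inj) /= ltn_eqF // => h.
  by rewrite add0r; congr (y _ _); apply: val_inj.
rewrite big1 // => j /eqP ij; rewrite UyE -(inj_eq val_inj) /= ij ltn_eqF // add0r.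
rewrite eqSS; case: eqP => [e|]; last by rewrite mul0r.
by case/eqP: ne; apply: val_inj.
Qed.

(** * Unipotent matrices with trivial first columns *)

Lemma colidM (n r : nat) (u v : 'M[F]_n) : colid r u -> colid r v -> colid r (u *m v).
Proof. by move=> hu hv; rewrite /colid -mulmxA hv. Qed.

Lemma colid_P (n r t : nat) (u : 'M[F]_n) : (t <= r)%N -> colid r u ->
  u *m (pid_mx t : 'M_(n, t)) = pid_mx t.
Proof.
move=> tr hu; have e : (pid_mx r : 'M[F]_n) *m (pid_mx t : 'M_(n, t)) = pid_mx t.
  by rewrite mul_pid_mx (minn_idPr tr) pid_mx_minv.
by rewrite -e mulmxA hu.
Qed.

Lemma colidP (n r : nat) (u : 'M[F]_n) :
  colid r u <-> forall i j : 'I_n, (j < r)%N -> u i j = (i == j)%:R.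
Proof.
split=> [/matrixP H i j lt|H].
  have := H i j; rewrite !mxE (bigD1 j) //= big1 ?addr0 => [|k /negbTE ne].
    rewrite mxE eqxx lt mulr1 => ->; case: eqP => [e|ne].
      by rewrite e lt (val_inj e) eqxx.
    by case: eqP => // e; case: ne; rewrite e.
  by rewrite mxE (_ : val k == val j = false) ?mulr0 // (inj_eq val_inj).
apply/matrixP=> i j; rewrite !mxE (bigD1 j) //= big1 ?addr0 => [|k /negbTE ne].
  rewrite mxE eqxx; have [lt|ge] := ltnP j r.
    rewrite H // mulr1; case: eqVneq => [->|/negbTE]; first by rewrite eqxx lt.
    by rewrite -(inj_eq val_inj) => ->.
  by rewrite mulr0; case: eqP => // ->; rewrite ltnNge ge.
by rewrite mxE (_ : val k == val j = false) ?mulr0 // (inj_eq val_inj).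
Qed.

Lemma colid_Uy (n t r : nat) (y : 'cV[F]_t) : (r <= t)%N -> colid r (Uy n y).
Proof.
move=> rt; apply/colidP=> i j lt; rewrite UyE.
by rewrite (ltn_eqF (leq_trans lt rt)) mul0r addr0.
Qed.

(** [Uy n (- y)] preserves the span of the first [t.+1] basis vectors, where [u] is the identity;
    [Uy n y] then undoes it. *)
Lemma colid_conj (n t : nat) (u : 'M[F]_n) (y : 'cV[F]_t) : colid t.+1 u ->
  colid t.+1 (Uy n y *m u *m Uy n (- y)).
Proof.
move=> hu; have hP := colid_P (leqnSn t) hu.
have key (z : 'cV_t) : Uy n z *m (pid_mx t.+1 : 'M_n)
           = pid_mx t.+1 + pid_mx t *m z *m (erow n t *m pid_mx t.+1).
  by rewrite /Uy mulmxDl mul1mx !mulmxA.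
rewrite /colid -!mulmxA key mulmxDr hu !mulmxA hP mulmxDr -mulmxA.
rewrite [_ *m (pid_mx t.+1)]key mulmxDl !mul1mx.
rewrite !mulmxA -[_ *m erow n t *m pid_mx t *m _ *m _ ]mulmxA.
rewrite -[_ *m erow n t *m pid_mx t]mulmxA erow_pid0 mulmx0 !mul0mx addr0.
by rewrite mulmxN !mulNmx addrK.
Qed.

(** One step of column elimination: [y] is the part of column [r] above the diagonal, and right
    multiplication by [Uy n (- y)] clears it. *)
Lemma colid_split (n r : nat) (u : 'M[F]_n) : unip u -> colid r u ->
  exists u' (y : 'cV[F]_r),
    [/\ unip u', colid r.+1 u' & u = u' *m Uy n y].
Proof.
move=> uu hu; pose y : 'cV[F]_r := pid_mx r *m u *m (erow n r)^T.
exists (u *m Uy n (- y)), y; split; last by rewrite -mulmxA -UyD addNr Uy0 mulmx1.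
  by rewrite unipM ?Uy_unip.
apply/colidP=> i j; rewrite ltnS leq_eqVlt => /orP[/eqP jr|lt]; last first.
  by move: i j lt; apply/colidP/colidM => //; apply: colid_Uy.
have /unipP[u0 u1] := uu.
have yE (k : 'I_r) (k' : 'I_n) : val k = val k' -> y k 0 = u k' j.
  move=> e; rewrite mxE (bigD1 j) //= big1 ?addr0 => [|h /negbTE ne].
    rewrite !mxE /= jr eqxx mulr1 (bigD1 k') //= big1 ?addr0 => [|h /negbTE ne].
      by rewrite mxE e eqxx -e ltn_ord mul1r.
    by rewrite mxE e eq_sym (inj_eq val_inj) ne mul0r.
  rewrite [(erow n r)^T _ _]mxE [erow _ _ _ _]mxE (_ : _ == r = false) ?mulr0 //.
  by rewrite -(inj_eq val_inj) /= jr in ne.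
clearbody y; have -> : (u *m Uy n (- y)) i j = u i j - (pid_mx r *m y) i 0.
  rewrite /Uy mulmxDr mulmx1 !mulmxA (colid_P (leqnn _) hu) mulmxN mulNmx mxE.
  congr (_ + _); rewrite mxE; congr (- _); rewrite mxE big_ord1.
  by rewrite [erow _ _ _ _]mxE /= jr eqxx mulr1; congr (_ _ _); apply: val_inj.
rewrite [(_ *m y) _ _]mxE.
have [lt|ge] := ltnP i r.
  rewrite (bigD1 (Ordinal lt)) //= big1 ?addr0 => [|h /negbTE ne].
    rewrite [pid_mx _ _ _]mxE eqxx lt mul1r (yE _ i) // subrr.
    by rewrite -(inj_eq val_inj) /= jr ltn_eqF.
  rewrite mxE (_ : val i == val h = false) ?mul0r //.
  by rewrite eq_sym -(inj_eq val_inj) in ne.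
rewrite big1 ?subr0 => [|h _]; last by rewrite mxE ltnNge ge andbF mul0r.
move: ge; rewrite leq_eqVlt => /orP[/eqP e|lt].
  by rewrite (_ : i = j) ?u1 ?eqxx //; apply: val_inj; rewrite /= jr.
by rewrite -jr in lt; rewrite u0 // -val_eqE gtn_eqF.
Qed.

Lemma mirabolic_split (t : nat) (X : 'M[F]_t.+1) :
  erow t.+1 t *m X = erow t.+1 t ->
  exists (y : 'cV[F]_t) (h : 'M[F]_t), X = Uy t.+1 y *m emb t.+1 h.
Proof.
move=> eX; exists (pid_mx t *m X *m (erow t.+1 t)^T), (pid_mx t *m X *m pid_mx t).
rewrite mulmxDl mul1mx -[_ *m erow _ _ *m _]mulmxA erow_emb // emb_pid //.
(* The identity splits into the projections to the first [t] coordinates and to the last one, which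
   expresses [X] through its blocks. *)
have E : (pid_mx t : 'M[F]_(t.+1, t)) *m (pid_mx t : 'M[F]_(t, t.+1))
          + (erow t.+1 t)^T *m erow t.+1 t = 1%:M.
  rewrite mul_pid_mx minnn (minn_idPr (leqnn _)).
  apply/matrixP=> i j; rewrite !mxE big_ord1 !mxE -(inj_eq val_inj) /=.
  case: (ltngtP i t) (ltn_ord i) => //= [lt _|lt|->]; rewrite ?mul0r ?addr0 ?andbT //.
    by rewrite ltnS leqNgt lt.
  by rewrite andbF add0r mul1r eq_sym.
have E1 : (pid_mx t : 'M[F]_(t.+1, t)) *m (pid_mx t : 'M[F]_(t, t.+1))
   = 1%:M - (erow t.+1 t)^T *m erow t.+1 t by rewrite -E addrK.
rewrite mulmxBr mulmxBl mulmx1 !mulmxA E1.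
have -> : (1%:M - (erow t.+1 t)^T *m erow t.+1 t) *m X = X - (erow t.+1 t)^T *m erow t.+1 t.
  by rewrite mulmxBl mul1mx -!mulmxA eX.
rewrite -!mulmxA E1; set e := _ *m erow t.+1 t.
rewrite [(X - e) *m (1%:M - e)]mulmxBr mulmx1; move: (_ *m e) => z; clearbody e.
rewrite -addrA [X in _ = _ + X]addrAC (subrK z) opprB [X in _ + X]addrA (subrK e).
by rewrite [RHS]addrC (subrK 1%:M).
Qed.

Lemma emb_unip (t n : nat) (h : 'M[F]_t) : (t <= n)%N -> unip h -> unip (emb n h).
Proof.
move=> tn /unipP[h0 h1]; apply/unipP; split=> [i j lt|i]; rewrite mxE.
  case: (insubP 'I_t (val i)) => [i' lti ei|nlt]; last first.
    by rewrite -val_eqE gtn_eqF.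
  rewrite (insubT (fun x => x < t)%N (ltn_trans lt lti)) h0 //= ei //.
case: (insubP 'I_t (val i)) => [i' lti ei|nlt]; first by rewrite h1.
by rewrite eqxx.
Qed.

Lemma mirabolic_unip (t : nat) (y : 'cV[F]_t) (h : 'M[F]_t) :
  unip h -> unip (Uy t.+1 y *m emb t.+1 h).
Proof. by move=> hu; rewrite unipM ?Uy_unip ?emb_unip. Qed.

(** Links the column groups that define derivatives to [unip] and [colid]; the sum on the right is
    the argument of [psi] in [deriv_char]. *)
Lemma Ucol_colid (n t : nat) (c : 'I_n) (u : 'M[F]_n) : (t <= c)%N -> Ucol c u ->
  [/\ unip u, colid t u & supdiag u = \sum_(i < n | (val i).+1 == val c) u i c].
Proof.
move=> tc /forallP H; have uE i j : u i j = if i == j then 1 else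
    if (j == c) && (i < c)%N then u i j else 0.
  have /forallP/(_ j) := H i.
  by case: (i == j) => [/eqP //|]; case: ifP => // _ /eqP.
split.
- apply/unipP; split=> [i j lt|i]; last by rewrite uE eqxx.
  rewrite uE -val_eqE gtn_eqF //; case: eqP => //= -> in lt *.
  by rewrite ltnNge ltnW.
- apply/colidP=> i j lt; rewrite uE; case: (i == j) => //.
  by rewrite -(val_eqE j) ltn_eqF ?(leq_trans lt tc).
rewrite /supdiag [RHS]big_mkcond /=; apply: eq_bigr => i _.
case: eqP => ic; last first.
  rewrite big1 // => j /eqP ij; rewrite uE -!val_eqE /= ij ltn_eqF //.
  by case: eqP.
rewrite (bigD1 c) //= ?ic // big1 ?addr0 // => j /andP[/eqP ij /eqP []].
by apply: val_inj; rewrite /= ij.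
Qed.

Lemma Ucol_Uy (n : nat) (c : 'I_n) (u : 'M[F]_n) : Ucol c u ->
  exists y : 'cV[F]_c, u = Uy n y.
Proof.
move=> /forallP H; exists (\col_i u (widen_ord (ltnW (ltn_ord c)) i) c).
apply/matrixP=> i j; rewrite UyE val_eqE; have /forallP/(_ j) := H i.
have [<- /eqP ->|ne] := eqVneq i j.
  case: eqP => [->|_]; last by rewrite mul0r addr0.
  by rewrite insubF ?ltnn //= mulr0 addr0.
rewrite add0r; case: eqP => [-> /=|_ /eqP ->]; last by rewrite mul0r.
case: insubP => [i' lt ei|]; last by move=> /negbTE -> /eqP ->; rewrite mulr0.
by move=> _; rewrite mul1r /= mxE; congr (u _ _); apply: val_inj.
Qed.

Lemma colid_full (n r : nat) (u : 'M[F]_n) : (n <= r)%N -> colid r u -> u = 1%:M.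
Proof. by move=> nr hu; rewrite -(mulmx1 u) -pid_mx_1 (colid_P nr hu). Qed.

Lemma colid_unip1 (n : nat) (u : 'M[F]_n) : unip u -> colid 1 u.
Proof.
move=> /unipP[u0 u1]; apply/colidP=> i j; rewrite ltnS leqn0 => /eqP j0.
have [->|ne] := eqVneq i j; first by rewrite u1.
by rewrite u0 // j0 lt0n -j0 val_eqE.
Qed.

(** A nonzero row has rank one, so its rank normal form is a scalar times the first row of
    [row_ebase a]; a transposition moves the first coordinate to the last. *)
Lemma row_transitive (t : nat) (a : 'rV[F]_t.+1) : a != 0 ->
  exists2 g : 'M[F]_t.+1, g \in unitmx & erow t.+1 t *m g = a.
Proof.
move=> a0; pose c := col_ebase a 0 0.
have c0 : c != 0.
  have := col_ebase_unit a; rewrite unitmxE unitfE; apply: contra => /eqP e.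
  by rewrite [col_ebase a]mx11_scalar -/c e det_scalar expr0n.
exists (c *: (tperm_mx ord0 ord_max *m row_ebase a)).
  by rewrite unitmxZ ?unitfE // unitmx_mul unitmx_perm row_ebase_unit.
rewrite -[RHS]mulmx_ebase rank_rV a0 -scalemxAr mulmxA.
rewrite [col_ebase a]mx11_scalar -/c mul_scalar_mx -scalemxAl; congr (_ *: (_ *m _)).
apply/rowP=> j; rewrite mxE (bigD1 ord_max) //= big1 ?addr0 => [|i /negbTE ne].
  by rewrite !mxE eqxx mul1r tpermR andbT.
by rewrite mxE (_ : val i == t = false) ?mul0r //; exact: ne.
Qed.
End Matrices.

(** * Characters and Bessel functions *)

Section AdditiveCharacter.
Variables (F : finFieldType) (A : comUnitRingType).

(** Nontriviality takes the strong form that some [1 - psi x] is invertible: when [A] has zero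
    divisors, [psi x != 1] would not permit cancellation in character sums. Fourier inversion
    divides by the order of [F]. *)
Definition additive_char (psi : F -> A) : Prop :=
  [/\ forall x y, psi (x + y) = psi x * psi y, psi 0 = 1,
      exists x, 1 - psi x \is a GRing.unit & (#|F|%:R : A) \is a GRing.unit].

Variable psi : F -> A.
Hypothesis psi_char : additive_char psi.

Let psiD x y : psi (x + y) = psi x * psi y. Proof. by case: psi_char. Qed.
Let psi0 : psi 0 = 1. Proof. by case: psi_char. Qed.
Let psi_nt : exists x, 1 - psi x \is a GRing.unit. Proof. by case: psi_char. Qed.
Let q_unit : (#|F|%:R : A) \is a GRing.unit. Proof. by case: psi_char. Qed.

Lemma charN x : psi (- x) * psi x = 1.
Proof. by rewrite -psiD addNr psi0. Qed.

Lemma char_unit x : psi x \is a GRing.unit.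
Proof. by apply/unitrPr; exists (psi (- x)); rewrite mulrC charN. Qed.

Lemma char_neg : additive_char (fun x => psi (- x)).
Proof.
split; rewrite ?oppr0 //; first by move=> x y; rewrite opprD psiD.
by have [x ux] := psi_nt; exists (- x); rewrite opprK.
Qed.

(** Translating the summation variable multiplies the sum by [psi x], so [1 - psi x] kills it. *)
Lemma sum_char_nontrivial (S : finZmodType) (f : S -> F) :
  {morph f : x y / x + y} -> (forall x, exists s, f s = x) ->
  \sum_(s : S) psi (f s) = 0.
Proof.
move=> fD fsurj; have [x ux] := psi_nt; have [s fs] := fsurj x.
apply: (mulrI ux); rewrite mulr0 mulrBl mul1r.
rewrite mulr_sumr [X in X - _](reindex_inj (addrI s)) /=.
by under eq_bigr => i _ do rewrite fD psiD fs; rewrite subrr.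
Qed.

Lemma mulmx_rV_surj (t : nat) (a : 'rV[F]_t) : a != 0 ->
  forall x, exists y : 'cV[F]_t, (a *m y) 0 0 = x.
Proof.
move=> a0 x; have [i ai] : exists i, a 0 i != 0 by apply/rV0Pn.
exists (\col_j (x / a 0 i * (j == i)%:R)); rewrite mxE (bigD1 i) //= big1 ?addr0.
  by rewrite mxE eqxx mulr1 mulrC divfK.
by move=> j /negbTE ne; rewrite mxE ne !mulr0.
Qed.

Lemma sum_char_row (t : nat) (y : 'cV[F]_t) : y != 0 ->
  \sum_(a : 'rV[F]_t) psi (- (a *m y) 0 0) = 0.
Proof.
move=> y0; apply: (@sum_char_nontrivial 'rV[F]_t (fun a => - (a *m y) 0 0)).
  by move=> a b; rewrite mulmxDl mxE opprD.
move=> x; have [|z e] := @mulmx_rV_surj t y^T _ (- x); first by rewrite trmx_eq0.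
exists z^T; have := congr1 (fun M : 'M_1 => M^T 0 0) (erefl (y^T *m z)).
by rewrite {1}trmx_mul trmxK => ->; rewrite mxE e opprK.
Qed.

(** Summing the coefficients over all [a], orthogonality leaves q^t times [f 0], and q is
    invertible. *)
Lemma fourier_inversion (t : nat) (f : 'cV[F]_t -> A) :
  (forall a : 'rV[F]_t, \sum_y psi (- (a *m y) 0 0) * f y = 0) -> f 0 = 0.
Proof.
move=> H; have : \sum_(a : 'rV[F]_t) \sum_y psi (- (a *m y) 0 0) * f y = 0.
  by rewrite big1.
rewrite exchange_big /= (bigD1 0) //= [X in _ + X]big1 => [|y y0]; last first.
  by rewrite -mulr_suml sum_char_row // mul0r.
under eq_bigr => a _ do rewrite mulmx0 mxE oppr0 psi0 mul1r.
rewrite sumr_const addr0 card_mx mul1n -mulr_natl natrX => e.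
by apply: (mulrI (unitrX t q_unit)); rewrite e mulr0.
Qed.

Lemma card_unip_unit (n : nat) :
  (#|[set u : 'M[F]_n | unip u]|%:R : A) \is a GRing.unit.
Proof.
(* N - 1 is an additive subgroup of the n x n matrices, so |N| divides q^(n^2). *)
pose S := [set X : 'M[F]_n | [forall i : 'I_n, forall j : 'I_n, (j <= i)%N ==> (X i j == 0)]].
have SP (X : 'M[F]_n) : reflect (forall i j : 'I_n, (j <= i)%N -> X i j = 0) (X \in S).
  rewrite inE; apply: (iffP forallP) => H i.
    by move=> j le; have /forallP/(_ j)/implyP/(_ le)/eqP := H i.
  by apply/forallP=> j; apply/implyP=> le; rewrite H.
have gS : group_set S.
  apply/group_setP; split=> [|X Y /SP hX /SP hY].
    by apply/SP => i j _; rewrite mxE.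
  by apply/SP=> i j le; rewrite mxE hX ?hY ?addr0.
have -> : #|[set u : 'M[F]_n | unip u]| = #|S|.
  rewrite -(card_imset (mem S) (addrI (1%:M : 'M[F]_n))); apply: eq_card => u; rewrite inE.
  apply/idP/imsetP=> [/unipP[u0 u1]|[X /SP hX ->]].
    exists (u - 1%:M); last by rewrite addrC subrK.
    apply/SP=> i j; rewrite leq_eqVlt => /orP[/eqP e|lt]; rewrite !mxE.
      by rewrite (val_inj e) u1 eqxx subrr.
    by rewrite u0 // -val_eqE gtn_eqF ?subrr.
  apply/unipP; split=> [i j lt|i]; rewrite !mxE hX ?addr0 // ?eqxx //; last exact: ltnW.
  by rewrite -val_eqE gtn_eqF.
have := cardSg (subsetT (Group gS)); rewrite cardsT card_mx /= => /dvdnP[d e].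
have := unitrX (n * n) q_unit; rewrite -natrX e natrM.
by rewrite unitrM => /andP[].
Qed.

Section Bessel.
Variables (n : nat) (J : 'M[F]_n -> A).
Hypothesis JL : forall u g, unip u -> g \in unitmx -> J (u *m g) = psi (supdiag u) * J g.
Hypothesis JR : forall u g, unip u -> g \in unitmx -> J (g *m u) = psi (supdiag u) * J g.

(* Commuting [emb n h] past [Uy n y] forces the last row of h to be that of the
   identity; peel off its last column and induct. *)
Lemma bessel_mirabolic (t : nat) (h : 'M[F]_t) : (t < n)%N -> h \in unitmx ->
  J (emb n h) != 0 -> unip h.
Proof.
elim: t h => [|t IH] h lt hu Jh; first by apply/unipP; split=> [[]|[]].
have eu : emb n h \in unitmx by rewrite emb_unit // ltnW.
have eh : erow F t.+1 t *m h = erow F t.+1 t.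
  apply/eqP; rewrite -subr_eq0; apply: contraNT Jh => /mulmx_rV_surj ne.
  (* [y] is chosen so that the last entries of [h *m y] and [y] differ by [x]; comparing both sides,
     [1 - psi x] kills [J (emb n h)]. *)
  have [x ux] := psi_nt; have [y e] := ne x.
  have : J (emb n h *m Uy n y) = J (Uy n (h *m y) *m emb n h).
    by rewrite emb_Uy // ltnW.
  rewrite JR ?JL ?Uy_unip ?supdiag_Uy //.
  rewrite -!erow_last mulmxA -[_ *m h](subrK (erow F t.+1 t)) mulmxDl.
  rewrite [X in _ = psi X * _]mxE e psiD -mulrA.
  move=> /eqP; rewrite -subr_eq0 -{1}[_ * J _]mul1r -mulrBl mulrI_eq0; last exact: mulrI.
  by rewrite mulrI_eq0 //; apply: mulrI; apply: char_unit.
have [y [h' hE]] := mirabolic_split eh.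
have h'u : h' \in unitmx.
  by move: hu; rewrite hE unitmx_mul Uy_unit emb_unit.
have le1 := ltnW lt; have le0 := ltnW le1.
rewrite hE mirabolic_unip // IH //; apply: contraNneq Jh => J0.
rewrite hE embM // emb_emb // emb_Uy_small // JL ?Uy_unip ?emb_unit //.
by rewrite J0 mulr0.
Qed.
End Bessel.
End AdditiveCharacter.

(** * Whittaker functionals and Bessel vectors *)

Section LinearForms.
Variables (A : comUnitRingType) (V : lmodType A).

Definition lin_form (f : V -> A) : Prop :=
  forall (a : A) (u v : V), f (a *: u + v) = a * f u + f v.

Variable f : V -> A.
Hypothesis f_lin : lin_form f.

Lemma lin0 : f 0 = 0.
Proof. by have := f_lin (-1) 0 0; rewrite scaler0 addr0 mulN1r addNr. Qed.

Lemma linD u v : f (u + v) = f u + f v.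
Proof. by have := f_lin 1 u v; rewrite scale1r mul1r. Qed.

Lemma linZ a v : f (a *: v) = a * f v.
Proof. by have := f_lin a v 0; rewrite lin0 !addr0. Qed.

Lemma linB u v : f (u - v) = f u - f v.
Proof. by rewrite -scaleN1r linD linZ mulN1r. Qed.

Lemma lin_sum (I : finType) (P : pred I) (h : I -> V) :
  f (\sum_(i | P i) h i) = \sum_(i | P i) f (h i).
Proof. by apply: (big_morph f); [apply: linD | apply: lin0]. Qed.

Lemma lin_inspan (S : V -> Prop) v :
  (forall w, S w -> f w = 0) -> inspan S v -> f v = 0.
Proof.
move=> fS [r [a [w [Sw ->]]]]; rewrite lin_sum big1 // => i _.
by rewrite linZ fS ?mulr0.
Qed.
End LinearForms.

Section WhittakerFunctionals.
Variables (F : finFieldType) (A : comUnitRingType) (psi : F -> A).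
Hypothesis psi_char : additive_char psi.
Variables (n : nat) (V : lmodType A) (rho : 'M[F]_n -> V -> V).
Hypothesis rho_rep : is_rep rho.

Lemma rep_sum g (I : finType) (P : pred I) (f : I -> V) : g \in unitmx ->
  rho g (\sum_(i | P i) f i) = \sum_(i | P i) rho g (f i).
Proof.
case: rho_rep => lin _ _ gu.
have r0 : rho g 0 = 0.
  by have := lin g gu (-1) 0 0; rewrite scaler0 addr0 scaleN1r addNr.
by apply: (big_morph (rho g)) => // x y; rewrite -[x]scale1r lin // !scale1r.
Qed.

Lemma repZ g a v : g \in unitmx -> rho g (a *: v) = a *: rho g v.
Proof.
move=> gu; case: rho_rep => lin _ _.
have r0 : rho g 0 = 0.
  by have := lin g gu (-1) 0 0; rewrite scaler0 addr0 scaleN1r addNr.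
by rewrite -[a *: v]addr0 lin // r0 addr0.
Qed.

Lemma repD g u v : g \in unitmx -> rho g (u + v) = rho g u + rho g v.
Proof.
by move=> gu; case: rho_rep => lin _ _; rewrite -[u]scale1r lin // !scale1r.
Qed.

Lemma repM g h v : g \in unitmx -> h \in unitmx -> rho (g *m h) v = rho g (rho h v).
Proof. by move=> gu hu; case: rho_rep => _ _; apply. Qed.

Lemma rep1 v : rho 1%:M v = v.
Proof. by case: rho_rep. Qed.

Variable l : V -> A.
Hypothesis l_gen : whit_gen rho psi l.

Lemma whit_lin : lin_form l.
Proof. by case: l_gen. Qed.

Lemma whit_unip u v : unip u -> l (rho u v) = psi (supdiag u) * l v.
Proof.
move=> uu; case: l_gen => _ _ ker.
apply/eqP; rewrite -subr_eq0 -(linZ whit_lin) -(linB whit_lin); apply/eqP/ker.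
exists 1%N, (fun=> 1), (fun=> rho u v - psi (supdiag u) *: v); split=> [_|].
  by exists u, v; split.
by rewrite big_ord1 scale1r.
Qed.

(** Average a preimage of 1 over the unipotent group against the inverse character; the order of
    that group is invertible in [A]. *)
Lemma bessel_vector : exists v0,
  l v0 = 1 /\ forall u, unip u -> rho u v0 = psi (supdiag u) *: v0.
Proof.
case: l_gen => _ onto _; have [v lv] := onto 1.
have psiD x y : psi (x + y) = psi x * psi y by case: psi_char.
pose N := [set u : 'M[F]_n | unip u].
have Nu := card_unip_unit psi_char n; rewrite -/N in Nu.
exists (#|N|%:R^-1 *: \sum_(u in N) psi (- supdiag u) *: rho u v); split.
  rewrite (linZ whit_lin) (lin_sum whit_lin) (eq_bigr (fun=> 1)) => [|u]; last first.
    by rewrite inE => uu; rewrite (linZ whit_lin) whit_unip // mulrA charN // lv mulr1.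
  by rewrite sumr_const mulVr.
move=> u uu; have u_un := unip_unit uu.
rewrite repZ // rep_sum // scalerA mulrC -scalerA scaler_sumr; congr (_ *: _).
rewrite [RHS](reindex_onto (mulmx u) (mulmx (invmx u))) /=; last first.
  by move=> w _; rewrite mulKVmx.
apply: eq_big => [w|w]; rewrite !inE.
  rewrite mulKmx // eqxx andbT; apply/idP/idP=> [|h]; first exact: unipM.
  by rewrite -(mulKmx u_un w) unipM // unip_invmx.
move=> wu; have w_un := unip_unit wu.
rewrite repZ // repM // supdiagM // opprD psiD scalerA mulrA.
by rewrite [psi (supdiag u) * _]mulrC charN // mul1r.
Qed.

End WhittakerFunctionals.

(** * Multiplicity one *)

Section DerivativeKernel.
Variables (F : finFieldType) (A : comUnitRingType) (psi : F -> A).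
Variables (n t : nat) (V : lmodType A) (rho : 'M[F]_n -> V -> V).
Hypothesis rho_rep : is_rep rho.
Variables (l f : V -> A).
Hypotheses (l_lin : lin_form l) (f_lin : lin_form f) (le_tn : (t <= n)%N).
Hypothesis f_rad : forall v, (forall g, g \in unitmx -> l (rho g v) = 0) -> f v = 0.
Hypothesis f_unip : forall u w, unip u -> colid t.+1 u ->
  f (rho u w) = psi (supdiag u) * f w.
Hypothesis f_Uy : (t < n)%N -> forall (y : 'cV_t) w, f (rho (Uy n y) w) = f w.

(** [f] depends only on Whittaker functions, so [v] may be replaced by a combination of derivative
    generators, each killed by equivariance. *)
Lemma model_deriv_ker_vanish v : model_deriv_ker (n - t) rho psi l v -> f v = 0.
Proof.
move=> [z [zS e]]; have : f (v - z) = 0.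
  apply: f_rad => g gu; rewrite -[v - z]addrC -scaleN1r.
  case: rho_rep => lin _ _; rewrite lin // (linD l_lin) (linZ l_lin) e //.
  by rewrite mulN1r addNr.
rewrite linB // (lin_inspan f_lin _ zS) ?subr0 // => {v z zS e} w.
move=> [c [u [v [tc uc ->]]]]; rewrite subKn // in tc.
rewrite linB // linZ // /deriv_char subKn //.
(* Column [t] carries the trivial character of the last step Psi^-; the later columns carry [psi]
   and fall under [f_unip]. *)
case: eqP => [ct|ne].
  have lt_tn : (t < n)%N by rewrite -ct ltn_ord.
  have [y ->] := Ucol_Uy uc; move: (f_Uy lt_tn); rewrite -ct => ->.
  by rewrite mul1r subrr.
have tc' : (t < c)%N by rewrite ltn_neqAle tc andbT eq_sym; apply/eqP.
have [uu cu su] := Ucol_colid tc' uc.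
by rewrite f_unip // su subrr.
Qed.
End DerivativeKernel.

Section Multiplicity.
Variables (F : finFieldType) (A : comUnitRingType) (psi : F -> A).
Hypothesis psi_char : additive_char psi.
Let psi' (x : F) := psi (- x).
Variables (n m : nat) (V V' : lmodType A).
Variables (rho : 'M[F]_n -> V -> V) (rho' : 'M[F]_m -> V' -> V').
Hypotheses (rho_rep : is_rep rho) (rho'_rep : is_rep rho').
Variables (l : V -> A) (l' : V' -> A).
Hypotheses (l_gen : whit_gen rho psi l) (l'_gen : whit_gen rho' psi' l').
Hypothesis lt_mn : (m < n)%N.

(* The equivariance reached after Fourier expansion along the columns m, ..., t+1.
   [stage_Uy] is void at t = m, where 'M_m has no column of index t. *)
Record stage (t : nat) (B : V -> V' -> A) : Prop := Stage {
  stage_linl : forall v', lin_form (B^~ v');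
  stage_linr : forall v, lin_form (B v);
  stage_radl : forall v v', (forall g, g \in unitmx -> l (rho g v) = 0) -> B v v' = 0;
  stage_radr : forall v v', (forall g, g \in unitmx -> l' (rho' g v') = 0) -> B v v' = 0;
  stage_unipl : forall u v v', unip u -> colid t.+1 u ->
    B (rho u v) v' = psi (supdiag u) * B v v';
  stage_unipr : forall u v v', unip u -> colid t.+1 u ->
    B v (rho' u v') = psi' (supdiag u) * B v v';
  stage_GL : forall (g : 'M_t) v v', g \in unitmx ->
    B (rho (emb n g) v) (rho' (emb m g) v') = B v v';
  stage_Uy : (t < m)%N -> forall (y : 'cV_t) v v',
    B (rho (Uy n y) v) (rho' (Uy m y) v') = B v v' }.

(** Only the V variable is translated: diagonal invariance turns a translation of V' into the
    inverse one of V. *)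
Definition fcoef (t : nat) (B : V -> V' -> A) (a : 'rV[F]_t) v v' : A :=
  \sum_(y : 'cV[F]_t) psi (- (a *m y) 0 0) * B (rho (Uy n y) v) v'.

Section Step.
Variables (t : nat) (B : V -> V' -> A).
Hypotheses (stB : stage t B) (le_tm : (t <= m)%N).
Let le_tn : (t <= n)%N. Proof. exact: leq_trans le_tm (ltnW lt_mn). Qed.
Let psiD x y : psi (x + y) = psi x * psi y. Proof. by case: psi_char. Qed.
Let psi0 : psi 0 = 1. Proof. by case: psi_char. Qed.

Lemma fcoef_linl (a : 'rV_t) v' : lin_form (fcoef B a ^~ v').
Proof.
move=> b u v; rewrite /fcoef mulr_sumr -big_split; apply: eq_bigr => y _ /=.
case: rho_rep => lin _ _; rewrite lin ?Uy_unit // (stage_linl stB) mulrDr.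
by rewrite mulrCA.
Qed.

Lemma fcoef_linr (a : 'rV_t) v : lin_form (fcoef B a v).
Proof.
move=> b u' v'; rewrite /fcoef mulr_sumr -big_split; apply: eq_bigr => y _ /=.
by rewrite (stage_linr stB) mulrDr mulrCA.
Qed.

Lemma fcoef_radl (a : 'rV_t) v v' :
  (forall g, g \in unitmx -> l (rho g v) = 0) -> fcoef B a v v' = 0.
Proof.
move=> H; rewrite /fcoef big1 // => y _; rewrite (stage_radl stB) ?mulr0 // => g gu.
by rewrite -repM ?Uy_unit // H // unitmx_mul gu Uy_unit.
Qed.

Lemma fcoef_radr (a : 'rV_t) v v' :
  (forall g, g \in unitmx -> l' (rho' g v') = 0) -> fcoef B a v v' = 0.
Proof.
by move=> H; rewrite /fcoef big1 // => y _; rewrite (stage_radr stB) ?mulr0.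
Qed.

(** Moving [u] across [Uy n y] conjugates it, which keeps [colid t.+1] and the superdiagonal sum. *)
Lemma fcoef_unipl (a : 'rV_t) u v v' : unip u -> colid t.+1 u ->
  fcoef B a (rho u v) v' = psi (supdiag u) * fcoef B a v v'.
Proof.
move=> uu cu; rewrite /fcoef mulr_sumr; apply: eq_bigr => y _.
have wE : Uy n y *m u = (Uy n y *m u *m Uy n (- y)) *m Uy n y.
  by rewrite -mulmxA -UyD addNr Uy0 mulmx1.
have wu : unip (Uy n y *m u *m Uy n (- y)) by rewrite !unipM ?Uy_unip.
rewrite -repM ?Uy_unit ?unip_unit // wE repM ?Uy_unit ?unip_unit //.
rewrite (stage_unipl stB) //; last exact: colid_conj.
rewrite mulrCA; congr (_ * _); congr (psi _).
rewrite !supdiagM ?unipM ?Uy_unip // addrAC -supdiagM ?Uy_unip // -UyD subrr Uy0.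
by rewrite supdiag1 add0r.
Qed.

Lemma fcoef_unipr (a : 'rV_t) u v v' : unip u -> colid t.+1 u ->
  fcoef B a v (rho' u v') = psi' (supdiag u) * fcoef B a v v'.
Proof.
move=> uu cu; rewrite /fcoef mulr_sumr; apply: eq_bigr => y _.
by rewrite (stage_unipr stB) // mulrCA.
Qed.

Lemma fcoef_Uyl (a : 'rV_t) (z : 'cV_t) v v' :
  fcoef B a (rho (Uy n z) v) v' = psi ((a *m z) 0 0) * fcoef B a v v'.
Proof.
rewrite /fcoef mulr_sumr [RHS](reindex_inj (addIr z)); apply: eq_bigr => y _ /=.
rewrite -repM ?Uy_unit // -UyD mulrA -psiD; congr (psi _ * _).
by rewrite mulmxDr [(a *m y + _) _ _]mxE opprD addrCA subrr addr0.
Qed.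

Lemma fcoef_Uyr (a : 'rV_t) (z : 'cV_t) v v' : (t < m)%N ->
  fcoef B a v (rho' (Uy m z) v') = psi' ((a *m z) 0 0) * fcoef B a v v'.
Proof.
move=> tm; rewrite /fcoef mulr_sumr (reindex_inj (addrI z)); apply: eq_bigr => y _ /=.
rewrite UyD repM ?Uy_unit // (stage_Uy stB) // mulrA /psi' -psiD.
by rewrite mulmxDr [(a *m z + _) _ _]mxE opprD.
Qed.

Lemma fcoef_GL (a : 'rV_t) (g : 'M_t) v v' : g \in unitmx ->
  fcoef B a (rho (emb n g) v) (rho' (emb m g) v') = fcoef B (a *m g) v v'.
Proof.
move=> gu; have injg : injective (mulmx g : 'cV_t -> 'cV_t).
  by move=> x y /(congr1 (mulmx (invmx g))); rewrite !mulKmx.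
rewrite /fcoef (reindex_inj injg); apply: eq_bigr => y _ /=.
rewrite -repM ?Uy_unit ?emb_unit // -emb_Uy // repM ?Uy_unit ?emb_unit //.
by rewrite (stage_GL stB) // mulmxA.
Qed.

Hypothesis nexc : ~ exceptional rho rho' psi psi'.

(** Were it nonzero, this coefficient would itself be an exceptional form at level [t]: for [a = 0]
    it is invariant under column [t] on each side and under all of GL_t. *)
Lemma fcoef0 v v' : (0 < t)%N -> fcoef B (0 : 'rV_t) v v' = 0.
Proof.
move=> t0; apply/eqP/contraT => ne; case: nexc; exists l, l'; do 2!split=> //.
exists t; split=> //; exists (fcoef B (0 : 'rV_t)); split.
- by split=> *; rewrite (fcoef_linl, fcoef_linr).
- move=> w w' wk; apply: (@model_deriv_ker_vanish _ _ psi n t V rho rho_rep l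
    (fcoef B (0 : 'rV_t) ^~ w')) wk => //.
  + exact: whit_lin l_gen.
  + exact: fcoef_linl.
  + by move=> *; apply: fcoef_radl.
  + by move=> *; apply: fcoef_unipl.
  + by move=> _ y w0; rewrite fcoef_Uyl mul0mx mxE psi0 mul1r.
- move=> w w' wk; apply: (@model_deriv_ker_vanish _ _ psi' m t V' rho' rho'_rep l'
    (fcoef B (0 : 'rV_t) w)) wk => //.
  + exact: whit_lin l'_gen.
  + exact: fcoef_linr.
  + by move=> *; apply: fcoef_radr.
  + by move=> *; apply: fcoef_unipr.
  + by move=> tm y w0; rewrite fcoef_Uyr // mul0mx mxE /psi' oppr0 psi0 mul1r.
- by move=> g gu w w'; rewrite fcoef_GL // mul0mx.
by exists v, v'.
Qed.

End Step.

(** The row [erow] is fixed by the mirabolic subgroup of GL_{t+1}, which contains GL_t and column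
    [t]: hence the last two clauses. For the unipotent clauses, [colid_split] peels off column
    [t.+1], where the coefficient transforms by [psi] of the superdiagonal entry. *)
Lemma stage_descend (t : nat) (B : V -> V' -> A) : (t < m)%N ->
  stage t.+1 B -> stage t (fcoef B (erow F t.+1 t)).
Proof.
move=> tm stB; have tn := leq_trans tm (ltnW lt_mn).
have psiD x y : psi (x + y) = psi x * psi y by case: psi_char.
split.
- by move=> v'; apply: fcoef_linl.
- by move=> v; apply: fcoef_linr.
- by move=> *; apply: (fcoef_radl stB).
- by move=> *; apply: (fcoef_radr stB).
- move=> u v v' uu cu; have [u' [y [u'u cu' ->]]] := colid_split uu cu.
  rewrite repM ?unip_unit ?Uy_unip // (fcoef_unipl stB) // fcoef_Uyl // mulrA -psiD.
  by rewrite supdiagM ?Uy_unip // supdiag_Uy ?erow_last // (leq_ltn_trans tm).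
(* When [t.+1 = m] there is no column [t.+1] on the V' side, and [u] is the identity. *)
- move=> u v v' uu cu; have [lt|ge] := ltnP t.+1 m; last first.
    by rewrite (colid_full ge cu) rep1 // supdiag1 /psi' oppr0;
      case: psi_char => _ -> _ _; rewrite mul1r.
  have [u' [y [u'u cu' ->]]] := colid_split uu cu.
  rewrite repM ?unip_unit ?Uy_unip // (fcoef_unipr stB) // (fcoef_Uyr stB) // mulrA -psiD.
  by rewrite /psi' supdiagM ?Uy_unip // supdiag_Uy ?erow_last // opprD.
- move=> g v v' gu; rewrite -(emb_emb g (leqnSn t)) // -[emb m g](emb_emb g (leqnSn t)) //.
  by rewrite (fcoef_GL stB) ?emb_unit // erow_emb.
move=> _ y v v'; rewrite -(emb_Uy_small y (ltnSn t) tn) -(emb_Uy_small y (ltnSn t) tm).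
by rewrite (fcoef_GL stB) ?Uy_unit // /Uy mulmxDr mulmx1 !mulmxA erow_pid0 !mul0mx addr0.
Qed.

Hypothesis nexc : ~ exceptional rho rho' psi psi'.
Variables (v0 : V) (v0' : V').
Hypotheses (l_v0 : l v0 = 1) (l'_v0' : l' v0' = 1).
Hypothesis v0_unip : forall u, unip u -> rho u v0 = psi (supdiag u) *: v0.

Theorem stage_eq0 (t : nat) (B : V -> V' -> A) : (t <= m)%N -> stage t B ->
  B v0 v0' = 0 -> forall v v', B v v' = 0.
Proof.
elim: t B => [|t IH] B tm stB B0 v v'.
  (* At level 0 the form is equivariant under all unipotent matrices, so in each variable it factors
     through the coinvariants, of rank one. *)
  have lin1 w w' : B w w' = l w * B v0 w'.
    apply/eqP; rewrite -subr_eq0 -(linZ (stage_linl stB w')) -(linB (stage_linl stB w')).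
    case: (l_gen) => _ _ ker; apply/eqP.
    apply: (lin_inspan (stage_linl stB w') (S := whit_gens rho psi)); last first.
      apply/ker; rewrite (linB (whit_lin l_gen)) (linZ (whit_lin l_gen)) l_v0 mulr1.
      exact: subrr.
    move=> _ [u [x [uu ->]]]; rewrite (linB (stage_linl stB w')) (linZ (stage_linl stB w')).
    by rewrite (stage_unipl stB) ?subrr //; apply: colid_unip1.
  have lin2 w w' : B w w' = l' w' * B w v0'.
    apply/eqP; rewrite -subr_eq0 -(linZ (stage_linr stB w)) -(linB (stage_linr stB w)).
    case: (l'_gen) => _ _ ker; apply/eqP.
    apply: (lin_inspan (stage_linr stB w) (S := whit_gens rho' psi')); last first.
      apply/ker; rewrite (linB (whit_lin l'_gen)) (linZ (whit_lin l'_gen)) l'_v0' mulr1.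
      exact: subrr.
    move=> _ [u [x [uu ->]]]; rewrite (linB (stage_linr stB w)) (linZ (stage_linr stB w)).
    by rewrite (stage_unipr stB) ?subrr //; apply: colid_unip1.
  by rewrite lin1 lin2 B0 !mulr0.
have psiD x y : psi (x + y) = psi x * psi y by case: psi_char.
(* Induction applies to this coefficient: at the Bessel pair each of its terms is a multiple of
   [B v0 v0'], because [v0] is an eigenvector. *)
have Ce : forall w w', fcoef B (erow F t.+1 t) w w' = 0.
  apply: IH; [exact: ltnW | exact: stage_descend |].
  rewrite /fcoef big1 // => y _; rewrite v0_unip ?Uy_unip //.
  by rewrite (linZ (stage_linl stB v0')) B0 !mulr0.
have : B (rho (Uy n (0 : 'cV_t.+1)) v) v' = 0; last by rewrite Uy0 rep1.
apply: (fourier_inversion psi_char (f := fun y => B (rho (Uy n y) v) v')) => a.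
have [->|a0] := eqVneq a 0; first exact: (fcoef0 stB).
have [g gu <-] := row_transitive a0.
by rewrite -/(fcoef B _ v v') -(fcoef_GL stB).
Qed.

End Multiplicity.

(** * The zeta integrals *)

Section Blocks.
Variable F : finFieldType.

Lemma diagmat_emb (m k : nat) (x : 'M[F]_m) : diagmat k x = emb (m + k.+1) x.
Proof.
have insub_r (i : 'I_k.+1) : insub (val (rshift m i)) = None :> option 'I_m.
  by rewrite insubF //= ltnNge leq_addr.
have insub_l (i : 'I_m) : insub (val (lshift k.+1 i)) = Some i.
  by rewrite /= valK.
apply/matrixP=> i j; rewrite [RHS]mxE.
case: (split_ordP i) => i0 ->; case: (split_ordP j) => j0 ->.
- by rewrite block_mxEul !insub_l.
- by rewrite block_mxEur insub_l insub_r mxE eq_lrshift.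
- by rewrite block_mxEdl insub_r mxE eq_rlshift.
- by rewrite block_mxEdr insub_r mxE eq_rshift.
Qed.

Lemma unip_block (a b : nat) (u : 'M[F]_a) (w : 'M[F]_(a, b)) (z : 'M[F]_(b, a))
    (v : 'M[F]_b) :
  unip (block_mx u w z v) = [&& unip u, unip v & z == 0].
Proof.
apply/idP/and3P=> [/unipP[h0 h1]|[/unipP[u0 u1] /unipP[v0 v1] /eqP->]].
  split.
  - apply/unipP; split=> [i j lt|i].
      by have := h0 (lshift b i) (lshift b j) lt; rewrite block_mxEul.
    by have := h1 (lshift b i); rewrite block_mxEul.
  - apply/unipP; split=> [i j lt|i].
      by have := h0 (rshift a i) (rshift a j); rewrite block_mxEdr /= ltn_add2l => ->.
    by have := h1 (rshift a i); rewrite block_mxEdr.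
  apply/eqP/matrixP=> i j; have := h0 (rshift a i) (lshift b j).
  by rewrite block_mxEdl mxE => -> //=; rewrite (leq_trans (ltn_ord j)) ?leq_addr.
apply/unipP; split=> [i j|i].
  case: (split_ordP i) => i0 ->; case: (split_ordP j) => j0 -> /= lt.
  - by rewrite block_mxEul u0.
  - by have := ltn_ord i0; lia.
  - by rewrite block_mxEdl mxE.
  - by rewrite block_mxEdr v0 // -(ltn_add2l a).
by case: (split_ordP i) => i0 ->; rewrite ?block_mxEul ?block_mxEdr.
Qed.

(** The superdiagonal meets [w] only in its lower left corner, which lies in the column assumed
    zero. *)
Lemma supdiag_block (a b : nat) (u : 'M[F]_a) (w : 'M[F]_(a, b)) (z : 'M[F]_(b, a))
    (v : 'M[F]_b) :
  (forall i (j : 'I_b), val j = 0%N -> w i j = 0) ->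
  supdiag (block_mx u w z v) = supdiag u + supdiag v.
Proof.
move=> w0; rewrite /supdiag big_split_ord /=; congr (_ + _); apply: eq_bigr => i _.
  rewrite big_mkcond big_split_ord /= -big_mkcond [X in _ + X]big1 ?addr0 => [|j _].
    by apply: eq_bigr => j _; rewrite block_mxEul.
  rewrite block_mxEur; case: eqP => // e; apply: w0.
  by have := ltn_ord i; move: e => /=; lia.
rewrite big_mkcond big_split_ord /= [X in X + _]big1 ?add0r => [|j _].
  rewrite -big_mkcond; apply: eq_big => j; first by rewrite -addnS eqn_add2l.
  by rewrite block_mxEdr.
by case: eqP => // e; have := ltn_ord j; lia.
Qed.

Lemma unip_colid_block (m k : nat) (u : 'M[F]_(m + k.+1)) : unip u -> colid m.+1 u ->
  exists (b : 'M_(m, k.+1)) (d : 'M_k.+1),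
    [/\ u = block_mx 1%:M b 0 d, unip d, forall i, b i 0 = 0 & forall i, d i 0 = (i == 0)%:R].
Proof.
move=> uu /colidP cu; exists (ursubmx u), (drsubmx u).
have e1 : ulsubmx u = 1%:M.
  apply/matrixP=> i j; rewrite !mxE cu ?eq_lshift //=.
  by rewrite ltnW // ltnS ltn_ord.
have e2 : dlsubmx u = 0.
  apply/matrixP=> i j; rewrite !mxE cu ?eq_rlshift //=.
  by rewrite ltnW // ltnS ltn_ord.
have e : u = block_mx 1%:M (ursubmx u) 0 (drsubmx u) by rewrite -e1 -e2 submxK.
split=> // [|i|i]; first by move: uu; rewrite {1}e unip_block => /and3P[].
  by rewrite !mxE cu ?eq_lrshift //= addn0.
by rewrite !mxE cu ?eq_rshift //= addn0.
Qed.

(* This anti-automorphism preserves the unipotent group and its character, and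
   exchanges the last-row mirabolic with the first-column one. *)
Definition antitr (n : nat) (g : 'M[F]_n) : 'M[F]_n :=
  \matrix_(i, j) g (rev_ord j) (rev_ord i).

Lemma antitrK (n : nat) : involutive (@antitr n).
Proof. by move=> g; apply/matrixP=> i j; rewrite !mxE !rev_ordK. Qed.

Lemma antitrM (n : nat) (g h : 'M[F]_n) : antitr (g *m h) = antitr h *m antitr g.
Proof.
apply/matrixP=> i j; rewrite !mxE (reindex_inj rev_ord_inj).
by apply: eq_bigr => l _; rewrite !mxE mulrC.
Qed.

Lemma antitr1 (n : nat) : antitr (1%:M : 'M[F]_n) = 1%:M.
Proof.
by apply/matrixP=> i j; rewrite !mxE (inj_eq rev_ord_inj) eq_sym.
Qed.

Lemma antitr_unit (n : nat) (g : 'M[F]_n) : g \in unitmx -> antitr g \in unitmx.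
Proof.
by move=> gu; have := antitrM g (invmx g); rewrite mulmxV // antitr1 => /esym/mulmx1_unit[].
Qed.

Lemma antitr_unip (n : nat) (g : 'M[F]_n) : unip g -> unip (antitr g).
Proof.
move=> /unipP[g0 g1]; apply/unipP; split=> [i j lt|i]; rewrite mxE ?g1 // g0 //=.
by have := ltn_ord i; lia.
Qed.

Lemma supdiag_antitr (n : nat) (g : 'M[F]_n) : supdiag (antitr g) = supdiag g.
Proof.
rewrite /supdiag !pair_big_dep /= [RHS](reindex_inj (h := fun p => (rev_ord p.2, rev_ord p.1))) /=.
  apply: eq_big => [[i j]|[i j] _] /=; last by rewrite mxE.
  by have := ltn_ord i; have := ltn_ord j; lia.
apply: (can_inj (g := fun p => (rev_ord p.2, rev_ord p.1))) => [[i j]] /=.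
by rewrite !rev_ordK.
Qed.


Lemma unip_cast (a b : nat) (e : a = b) (u : 'M[F]_a) : unip (castmx (e, e) u) = unip u.
Proof. by case: b / e. Qed.

Lemma supdiag_cast (a b : nat) (e : a = b) (u : 'M[F]_a) :
  supdiag (castmx (e, e) u) = supdiag u.
Proof. by case: b / e. Qed.

Lemma castM (a b c : nat) (e : a = b) (u : 'M[F]_a) (w : 'M[F]_(a, c)) :
  castmx (e, erefl) (u *m w) = castmx (e, e) u *m castmx (e, erefl) w.
Proof. by case: b / e. Qed.

Lemma castMr (a b c d : nat) (e : a = b) (w : 'M[F]_(a, c)) (v : 'M[F]_(c, d)) :
  castmx (e, erefl) (w *m v) = castmx (e, erefl) w *m v.
Proof. by case: b / e. Qed.

Lemma cast_unit (a b : nat) (e : a = b) (u : 'M[F]_a) :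
  (castmx (e, e) u \in unitmx) = (u \in unitmx).
Proof. by case: b / e. Qed.

Let ebig (m k : nat) : (k.+1 + m = m + k.+1)%N := bigmat_eqr m k.

Lemma bigmat_block (m k : nat) (x : 'M[F]_m) (y : 'M_(m, k)) :
  bigmat x y = castmx (ebig m k, erefl)
    (block_mx 0 1%:M x (row_mx (0 : 'M_(m, 1)) y : 'M_(m, k.+1)) : 'M_(k.+1 + m, m + k.+1)).
Proof.
apply/matrixP=> i j; rewrite !castmxE /= cast_ord_id.
move: (cast_ord _ i) => {}i.
have cl (j0 : 'I_m) : cast_ord (esym (bigmat_eqc m k)) (lshift k.+1 j0) =
    lshift k (lshift 1 j0) by apply: val_inj.
have cr1 (j0 : 'I_1) : cast_ord (esym (bigmat_eqc m k)) (rshift m (lshift k j0)) =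
    lshift k (rshift m j0) by apply: val_inj.
have cr2 (j0 : 'I_k) : cast_ord (esym (bigmat_eqc m k)) (rshift m (rshift 1 j0)) =
    rshift (m + 1) j0 by apply: val_inj => /=; lia.
case: (split_ordP j) => j0 ->.
  rewrite cl; case: (split_ordP i) => i0 ->; last first.
    by rewrite block_mxEdl col_mxEd !row_mxEl.
  rewrite block_mxEul col_mxEu; case: (split_ordP (i0 : 'I_(1 + k))) => i1 ->.
    by rewrite col_mxEu !row_mxEl !mxE.
  by rewrite col_mxEd !row_mxEl !mxE.
case: (split_ordP (j0 : 'I_(1 + k))) => j1 ->; rewrite ?cr1 ?cr2.
  case: (split_ordP i) => i0 ->; last first.
    by rewrite block_mxEdr col_mxEd row_mxEl row_mxEr; exact: esym (row_mxEl 0 y i0 j1).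
  rewrite block_mxEur col_mxEu; case: (split_ordP (i0 : 'I_(1 + k))) => i1 ->.
    by rewrite col_mxEu row_mxEl row_mxEr !mxE -!val_eqE.
  by rewrite col_mxEd row_mxEl row_mxEr !mxE -!val_eqE /= (ord1 j1).
case: (split_ordP i) => i0 ->; last first.
  by rewrite block_mxEdr col_mxEd row_mxEr; exact: esym (row_mxEr (0 : 'M_(m, 1)) y i0 j1).
rewrite block_mxEur col_mxEu; case: (split_ordP (i0 : 'I_(1 + k))) => i1 ->.
  by rewrite col_mxEu row_mxEr !mxE -!val_eqE /= (ord1 i1).
by rewrite col_mxEd row_mxEr !mxE -!val_eqE.
Qed.

(** The right factor that makes [bigmat] block lower triangular; translating a vector by its inverse
    brings the dual sum within reach of the support of the Bessel function. *)
Definition swapmx (m k : nat) : 'M[F]_(m + k.+1) :=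
  castmx (ebig m k, erefl) (block_mx 0 1%:M 1%:M 0 : 'M_(k.+1 + m, m + k.+1)).

Lemma swapmx_unit (m k : nat) : swapmx m k \in unitmx.
Proof.
have : swapmx m k *m castmx (erefl, ebig m k)
    (block_mx 0 1%:M 1%:M 0 : 'M[F]_(m + k.+1, k.+1 + m)) = 1%:M.
  rewrite /swapmx; set S := block_mx _ _ _ _; set S' := block_mx _ _ _ _.
  have SS : S *m S' = 1%:M.
    by rewrite mulmx_block !mulmx0 !mul0mx !mulmx1 !addr0 !add0r scalar_mx_block.
  suff gen a b (e : a = b) (M : 'M[F]_(a, b)) (M' : 'M_(b, a)) : M *m M' = 1%:M ->
    castmx (e, erefl) M *m castmx (erefl, e) M' = 1%:M by exact: gen.
  by case: b / e M M'.
by move=> /mulmx1_unit[].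
Qed.

Definition lowmat (m k : nat) (x : 'M[F]_m) (y : 'M_(m, k)) : 'M[F]_(m + k.+1) :=
  castmx (ebig m k, ebig m k)
    (block_mx 1%:M 0 (row_mx (0 : 'M_(m, 1)) y : 'M_(m, k.+1)) x).

Lemma bigmat_low (m k : nat) (x : 'M[F]_m) (y : 'M_(m, k)) :
  bigmat x y = lowmat x y *m swapmx m k.
Proof.
rewrite bigmat_block -castM mulmx_block.
by rewrite !mulmx0 !mul0mx !mulmx1 ?mul1mx !addr0 !add0r.
Qed.

Lemma lowmat_unit (m k : nat) (x : 'M[F]_m) (y : 'M_(m, k)) :
  x \in unitmx -> lowmat x y \in unitmx.
Proof.
by move=> xu; rewrite cast_unit unitmxE det_lblock det1 mul1r -unitmxE.
Qed.

Lemma lowmat_unip (m k : nat) (x : 'M[F]_m) (y : 'M_(m, k)) :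
  unip (lowmat x y) = unip x && (y == 0).
Proof.
have := row_mx_eq0 (0 : 'M[F]_(m, 1)) y; rewrite eqxx /= => e.
by rewrite unip_cast unip_block unip1 /=; congr (_ && _); exact: e.
Qed.

Lemma supdiag_low (m k : nat) (x : 'M[F]_m) (y : 'M_(m, k)) :
  supdiag (lowmat x y) = supdiag x.
Proof.
by rewrite supdiag_cast supdiag_block ?supdiag1 ?add0r // => i j _; rewrite mxE.
Qed.

(** The first column of [lowmat x y] is that of the identity, thanks to the zero column before [y];
    [antitr] turns it into the last row. *)
Lemma lowmat_lastrow (m k : nat) (x : 'M[F]_m) (y : 'M_(m, k)) :
  erow F (m + k.+1) (m + k) *m antitr (lowmat x y) = erow F (m + k.+1) (m + k).
Proof.
have lt : (m + k < m + k.+1)%N by rewrite addnS.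
apply/rowP=> j; rewrite !mxE (bigD1 (Ordinal lt)) //= big1 ?addr0 => [|i ne]; last first.
  rewrite mxE (_ : val i == _ = false) ?mul0r //; apply: contraNF ne => /eqP e.
  by apply/eqP/val_inj.
rewrite !mxE eqxx mul1r castmxE /=.
have -> : cast_ord (esym (ebig m k)) (rev_ord (Ordinal lt)) = lshift m (ord0 : 'I_k.+1).
  by apply: val_inj => /=; lia.
have je : (val j == (m + k)%N) =
    (cast_ord (esym (ebig m k)) (rev_ord j) == lshift m (ord0 : 'I_k.+1)).
  by rewrite -val_eqE /=; have := ltn_ord j; lia.
rewrite je; move: (cast_ord _ (rev_ord j)) => {je j} j; case: (split_ordP j) => j0 ->.
  by rewrite block_mxEul mxE (inj_eq (@lshift_inj _ _)).
rewrite block_mxEdl eq_rlshift.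
transitivity (row_mx (0 : 'M_(m, 1)) y j0 (lshift k ord0)); last by rewrite row_mxEl mxE.
by congr (row_mx _ _ _ _); apply: val_inj.
Qed.

Lemma bigmat_unit (m k : nat) (x : 'M[F]_m) (y : 'M_(m, k)) :
  x \in unitmx -> bigmat x y \in unitmx.
Proof. by move=> xu; rewrite bigmat_low unitmx_mul lowmat_unit ?swapmx_unit. Qed.

End Blocks.

(** * Sums over the general linear group and its cosets *)

Section Cosets.
Variables (F : finFieldType) (A : comUnitRingType) (m : nat).

Lemma Nrel_equivalence : {in GLset F m & &, equivalence_rel (@Nrel F m)}.
Proof.
move=> x y z; rewrite !inE => xu yu zu; split.
  by apply/existsP; exists 1%:M; rewrite unip1 mul1mx eqxx.
move=> /existsP[u /andP[uu /eqP ->]].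
apply/existsP/existsP => -[w /andP[wu /eqP ->]].
  exists (w *m invmx u); rewrite unipM ?unip_invmx // -mulmxA mulKmx ?unip_unit //.
  exact: eqxx.
by exists (w *m u); rewrite unipM // mulmxA eqxx.
Qed.

(** Each block of the partition is an orbit of the unipotent group, which acts freely by left
    multiplication. *)
Lemma sum_cosetreps (f : 'M[F]_m -> A) :
  (forall u x, unip u -> x \in unitmx -> f (u *m x) = f x) ->
  \sum_(x in GLset F m) f x
  = #|[set u : 'M[F]_m | unip u]|%:R * \sum_(x in cosetreps F m) f x.
Proof.
move=> fN; have partP := equivalence_partitionP Nrel_equivalence.
have trP := transversalP partP.
rewrite (set_partition_big _ partP) -{1}(pblock_transversal trP).
rewrite big_imset; last exact: (pblock_inj trP).
rewrite mulr_sumr; apply: eq_bigr => r rX.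
have rG : r \in GLset F m := subsetP (transversal_sub trP) r rX.
have ru : r \in unitmx by rewrite inE in rG.
have -> : pblock (equivalence_partition (@Nrel F m) (GLset F m)) r
        = (mulmx^~ r) @: [set u : 'M[F]_m | unip u].
  apply/setP=> x; apply/idP/imsetP.
    move=> xr; have xG : x \in GLset F m.
      rewrite -(cover_partition partP); apply/bigcupP.
      by exists (pblock (equivalence_partition (@Nrel F m) (GLset F m)) r) => //;
        apply: pblock_mem; rewrite (cover_partition partP).
    move: xr; rewrite (pblock_equivalence_partition Nrel_equivalence) //.
    by move=> /existsP[u /andP[uu /eqP ->]]; exists u; rewrite ?inE.
  move=> [u]; rewrite inE => uu ->.
  rewrite (pblock_equivalence_partition Nrel_equivalence) //.
    by apply/existsP; exists u; rewrite uu eqxx.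
  by rewrite inE unitmx_mul ru unip_unit.
rewrite big_imset => [|u w _ _ e]; last by rewrite -(mulmxK ru u) e mulmxK.
rewrite (eq_bigr (fun=> f r)) => [|u]; last by rewrite inE => uu; apply: fN.
by rewrite sumr_const mulr_natl.
Qed.

Lemma sum_unip (f : 'M[F]_m -> A) :
  (forall x, x \in unitmx -> ~~ unip x -> f x = 0) -> (forall x, unip x -> f x = 1) ->
  \sum_(x in GLset F m) f x = #|[set u : 'M[F]_m | unip u]|%:R.
Proof.
move=> f0 f1; rewrite (bigID (fun x => unip x)) /= [X in _ + X]big1 ?addr0 => [|x].
  rewrite (eq_bigr (fun=> 1)) => [|x /andP[_ /f1] //].
  rewrite -sumr_const; apply: eq_bigl => x; rewrite !inE andb_idl //.
  exact: unip_unit.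
by rewrite inE => /andP[]; apply: f0.
Qed.

Lemma sum_GL_mulr (g : 'M[F]_m) (f : 'M[F]_m -> A) : g \in unitmx ->
  \sum_(x in GLset F m) f (x *m g) = \sum_(x in GLset F m) f x.
Proof.
move=> gu; rewrite [RHS](reindex_inj (h := mulmx^~ g)) /=.
  by apply: eq_bigl => x; rewrite !inE unitmx_mul gu andbT.
by move=> x y e; rewrite -(mulmxK gu x) e mulmxK.
Qed.
End Cosets.

(** The unipotent factor of [mirabolic_split] only contributes a character value, which leaves
    [bessel_mirabolic]. The size enters through an equation because [m + k.+1] is not literally a
    successor. *)
Lemma bessel_lastrow (F : finFieldType) (A : comUnitRingType) (psi : F -> A)
    (n t : nat) (J : 'M[F]_n -> A) (X : 'M[F]_n) :
  additive_char psi ->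
  (forall u g, unip u -> g \in unitmx -> J (u *m g) = psi (supdiag u) * J g) ->
  (forall u g, unip u -> g \in unitmx -> J (g *m u) = psi (supdiag u) * J g) ->
  n = t.+1 -> X \in unitmx -> erow F n t *m X = erow F n t -> J X != 0 -> unip X.
Proof.
move=> psi_char JL JR nt; subst n => Xu eX.
have [y [h Xe]] := mirabolic_split eX.
have hu : h \in unitmx by move: Xu; rewrite Xe unitmx_mul Uy_unit emb_unit.
move=> JX; rewrite Xe mirabolic_unip // (bessel_mirabolic psi_char JL JR _ hu) //.
apply: contraNneq JX => J0.
by rewrite Xe JL ?Uy_unip ?emb_unit // J0 mulr0.
Qed.

(** Two generators have the same kernel, which contains [w - l w *: v0]. This matters because each
    function in [whittaker_model] comes with its own generator. *)
Lemma whit_gen_proportional (F : finFieldType) (A : comUnitRingType) (psi : F -> A)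
    (n : nat) (V : lmodType A) (rho : 'M[F]_n -> V -> V) (l l1 : V -> A) v0 w :
  whit_gen rho psi l -> whit_gen rho psi l1 -> l v0 = 1 -> l1 w = l1 v0 * l w.
Proof.
move=> lg l1g lv0; have [_ _ ker] := lg; have [_ _ ker1] := l1g.
apply/eqP; rewrite -subr_eq0 mulrC -(linZ (whit_lin l1g)) -(linB (whit_lin l1g)).
apply/eqP/ker1/ker; rewrite (linB (whit_lin lg)) (linZ (whit_lin lg)) lv0 mulr1.
exact: subrr.
Qed.

Section ZetaIntegrals.
Variables (F : finFieldType) (A : comUnitRingType) (psi : F -> A).
Hypothesis psi_char : additive_char psi.
Let psi' (x : F) := psi (- x).
Variables (m k : nat) (V V' : lmodType A).
Let n := (m + k.+1)%N.
Variables (rho : 'M[F]_n -> V -> V) (rho' : 'M[F]_m -> V' -> V').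
Hypotheses (rho_rep : is_rep rho) (rho'_rep : is_rep rho').
Variables (l : V -> A) (l' : V' -> A).
Hypotheses (l_gen : whit_gen rho psi l) (l'_gen : whit_gen rho' psi' l').
Let le_mn : (m <= n)%N. Proof. exact: leq_addr. Qed.

(** Summing over the whole group makes invariance under GL_m a change of variable; the coset sum
    differs by the order of the unipotent group, a unit. *)
Definition zeta_form (v : V) (v' : V') : A :=
  \sum_(x in GLset F m) l (rho (emb n x) v) * l' (rho' x v').

Definition dual_zeta_form (v : V) (v' : V') : A :=
  \sum_(x in GLset F m) \sum_(y : 'M[F]_(m, k)) l (rho (bigmat x y) v) * l' (rho' x v').

Lemma rep_lin (a : A) g u v : g \in unitmx ->
  l (rho g (a *: u + v)) = a * l (rho g u) + l (rho g v).
Proof. by move=> gu; rewrite repD // repZ // (linD (whit_lin l_gen)) (linZ (whit_lin l_gen)). Qed.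

Lemma rep'_lin (a : A) g u v : g \in unitmx ->
  l' (rho' g (a *: u + v)) = a * l' (rho' g u) + l' (rho' g v).
Proof. by move=> gu; rewrite repD // repZ // (linD (whit_lin l'_gen)) (linZ (whit_lin l'_gen)). Qed.

Lemma zeta_form_stage : stage psi rho rho' l l' m zeta_form.
Proof.
split.
- move=> v' a u v; rewrite /zeta_form mulr_sumr -big_split; apply: eq_bigr => x.
  by rewrite inE => xu; rewrite /= rep_lin ?emb_unit // mulrDl mulrA.
- move=> v a u v'; rewrite /zeta_form mulr_sumr -big_split; apply: eq_bigr => x.
  by rewrite inE => xu; rewrite /= rep'_lin // mulrDr mulrCA.
- move=> v v' H; rewrite /zeta_form big1 // => x; rewrite inE => xu.
  by rewrite H ?mul0r ?emb_unit.
- move=> v v' H; rewrite /zeta_form big1 // => x; rewrite inE => xu.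
  by rewrite H ?mulr0.
- move=> u v v' uu cu; rewrite /zeta_form mulr_sumr; apply: eq_bigr => x.
  rewrite inE => xu; rewrite -repM ?emb_unit // ?unip_unit //.
  have [b [d [ue du b0 d0]]] := unip_colid_block uu cu.
  (* Moving [u] to the left replaces [b] by [x *m b], whose first column is still zero, so the
     superdiagonal sum is unchanged. *)
  have xE : emb n x *m u = block_mx 1%:M (x *m b) 0 d *m emb n x.
    rewrite -diagmat_emb ue !mulmx_block.
    by rewrite !mulmx0 !mul0mx ?mulmx1 ?mul1mx !addr0 !add0r.
  have wu : unip (block_mx 1%:M (x *m b) 0 d) by rewrite unip_block unip1 du eqxx.
  rewrite xE repM ?emb_unit // ?unip_unit // (whit_unip l_gen) // mulrA.
  congr (psi _ * _ * _); rewrite ue !supdiag_block // => i j j0.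
    by rewrite (_ : j = 0) ?b0 //; apply: val_inj.
  rewrite (_ : j = 0); last exact: val_inj.
  by rewrite mxE big1 // => h _; rewrite b0 mulr0.
- move=> u v v' uu cu; rewrite (colid_full (leqnSn m) cu) rep1 // supdiag1 oppr0.
  by case: psi_char => _ -> _ _; rewrite mul1r.
- move=> g v v' gu; rewrite /zeta_form -[RHS](sum_GL_mulr _ gu); apply: eq_bigr => x.
  by rewrite inE => xu; rewrite emb_id -!repM ?emb_unit // -embM.
by rewrite ltnn.
Qed.

Lemma dual_zeta_form_stage : stage psi rho rho' l l' m dual_zeta_form.
Proof.
split.
- move=> v' a u v; rewrite /dual_zeta_form mulr_sumr -big_split; apply: eq_bigr => x.
  rewrite inE => xu; rewrite mulr_sumr -big_split; apply: eq_bigr => y _.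
  by rewrite /= rep_lin ?bigmat_unit // mulrDl mulrA.
- move=> v a u v'; rewrite /dual_zeta_form mulr_sumr -big_split; apply: eq_bigr => x.
  rewrite inE => xu; rewrite mulr_sumr -big_split; apply: eq_bigr => y _.
  by rewrite /= rep'_lin // mulrDr mulrCA.
- move=> v v' H; rewrite /dual_zeta_form big1 // => x; rewrite inE => xu.
  by rewrite big1 // => y _; rewrite H ?mul0r ?bigmat_unit.
- move=> v v' H; rewrite /dual_zeta_form big1 // => x; rewrite inE => xu.
  by rewrite big1 // => y _; rewrite H ?mulr0.
- move=> u v v' uu cu; rewrite /dual_zeta_form mulr_sumr; apply: eq_bigr => x.
  rewrite inE => xu; rewrite mulr_sumr.
  have [b [d [ue du b0 d0]]] := unip_colid_block uu cu.
  pose z (y : 'M[F]_(m, k)) : 'M[F]_(m, k.+1) := row_mx (0 : 'M_(m, 1)) y.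
  have z0 y i : z y i 0 = 0.
    transitivity (row_mx (0 : 'M_(m, 1)) y i (lshift k ord0)); last by rewrite row_mxEl mxE.
    by congr (row_mx _ _ _ _); apply: val_inj.
  (* Right multiplication by [u] changes the block [z y] into [x *m b + z y *m d], whose first
     column vanishes; [h y] is what remains, and [h] is injective as [d] is invertible. *)
  pose h (y : 'M[F]_(m, k)) : 'M[F]_(m, k) :=
    rsubmx (x *m b + z y *m d : 'M_(m, 1 + k)).
  have zh y : z (h y) = x *m b + z y *m d.
    have M0 i : (x *m b + z y *m d) i 0 = 0.
      rewrite mxE [X in X + _]mxE big1 ?add0r => [|c _]; last by rewrite b0 mulr0.
      rewrite mxE (bigD1 0) //= z0 mul0r add0r big1 // => c c0.
      by rewrite d0 (negbTE c0) mulr0.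
    have -> : z (h y) = row_mx (lsubmx (x *m b + z y *m d : 'M_(m, 1 + k))) (h y).
      apply: (congr1 (fun c : 'M_(m, 1) => row_mx c (h y) : 'M_(m, k.+1))).
      apply/matrixP=> i j; rewrite [LHS]mxE [RHS]mxE -(M0 i) ord1.
      by congr (fun_of_matrix _ _ _); apply: val_inj.
    exact: (hsubmxK (_ : 'M_(m, 1 + k))).
  have hinj : injective h.
    move=> y1 y2 e; suff zz : z y1 = z y2.
      by case: (eq_row_mx (zz : row_mx (0 : 'M[F]_(m, 1)) y1 = row_mx (0 : 'M_(m, 1)) y2)).
    apply: (can_inj (mulmxK (unip_unit du))); apply: (addrI (x *m b)).
    by rewrite -!zh e.
  rewrite [RHS](reindex_inj hinj); apply: eq_bigr => y _ /=.
  rewrite -repM ?bigmat_unit // ?unip_unit //.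
  (* The part of [u] that comes out on the left; it has the same superdiagonal sum as [u]. *)
  pose w : 'M[F]_n := castmx (bigmat_eqr m k, bigmat_eqr m k) (block_mx d 0 0 1%:M).
  have wE : bigmat x y *m u = w *m bigmat x (h y).
    rewrite !bigmat_block -castM -castMr ue; congr (castmx _ _).
    rewrite !mulmx_block -/(z _) -/(z _) zh.
    by rewrite !mulmx0 !mul0mx ?mulmx1 ?mul1mx ?addr0 ?add0r.
  have wu : unip w by rewrite unip_cast unip_block du unip1 eqxx.
  rewrite wE repM ?bigmat_unit // ?unip_unit // (whit_unip l_gen) // mulrA.
  congr (psi _ * _ * _); rewrite supdiag_cast ue !supdiag_block ?supdiag1 ?addr0 ?add0r //.
    by move=> i j j0; rewrite (_ : j = 0) ?b0 //; apply: val_inj.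
  by move=> i j j0; rewrite mxE.
- move=> u v v' uu cu; rewrite (colid_full (leqnSn m) cu) rep1 // supdiag1 oppr0.
  by case: psi_char => _ -> _ _; rewrite mul1r.
- move=> g v v' gu; rewrite /dual_zeta_form -[RHS](sum_GL_mulr _ gu); apply: eq_bigr => x.
  rewrite inE => xu; apply: eq_bigr => y _.
  rewrite emb_id -!repM ?emb_unit ?bigmat_unit //; congr (l (rho _ _) * _).
  rewrite !bigmat_block -castMr -diagmat_emb mulmx_block.
  by rewrite !mulmx0 !mul0mx ?mulmx1 ?mul1mx ?addr0 ?add0r.
by rewrite ltnn.
Qed.

(** Serves to compare the two integrals: [stage_eq0] is applied to their difference. *)
Lemma stage_subZ t (B C : V -> V' -> A) (c : A) :
  stage psi rho rho' l l' t B -> stage psi rho rho' l l' t C ->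
  stage psi rho rho' l l' t (fun v v' => B v v' - c * C v v').
Proof.
case=> b1 b2 b3 b4 b5 b6 b7 b8 [c1 c2 c3 c4 c5 c6 c7 c8]; split.
- by move=> v' a u v; rewrite (b1 v') (c1 v') /=; ring.
- by move=> v a u v'; rewrite (b2 v) (c2 v); ring.
- by move=> *; rewrite b3 ?c3 // mulr0 subr0.
- by move=> *; rewrite b4 ?c4 // mulr0 subr0.
- by move=> *; rewrite b5 ?c5 // mulrBr (mulrCA c).
- by move=> *; rewrite b6 ?c6 // mulrBr (mulrCA c).
- by move=> *; rewrite b7 ?c7.
by move=> *; rewrite b8 ?c8.
Qed.

Variables (v0 : V) (v0' : V').
Hypotheses (l_v0 : l v0 = 1) (l'_v0' : l' v0' = 1).
Hypothesis v0_unip : forall u, unip u -> rho u v0 = psi (supdiag u) *: v0.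

Let J (g : 'M[F]_n) : A := l (rho g v0).

Lemma besselL u g : unip u -> g \in unitmx -> J (u *m g) = psi (supdiag u) * J g.
Proof. by move=> uu gu; rewrite /J repM // ?unip_unit // (whit_unip l_gen). Qed.

Lemma besselR u g : unip u -> g \in unitmx -> J (g *m u) = psi (supdiag u) * J g.
Proof.
move=> uu gu; rewrite /J repM // ?unip_unit // v0_unip // repZ //.
by rewrite (linZ (whit_lin l_gen)).
Qed.

Lemma bessel_unip u : unip u -> J u = psi (supdiag u).
Proof. by move=> uu; rewrite /J (whit_unip l_gen) // l_v0 mulr1. Qed.

Lemma whit'_unip u : unip u -> l' (rho' u v0') = psi (- supdiag u).
Proof. by move=> uu; rewrite (whit_unip l'_gen) // l'_v0' mulr1. Qed.

Lemma zeta_form_bessel : zeta_form v0 v0' = #|[set u : 'M[F]_m | unip u]|%:R.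
Proof.
apply: sum_unip => [x xu nx|x xu].
  suff : J (emb n x) == 0 by rewrite /J => /eqP ->; rewrite mul0r.
  apply: contraNT nx => Jx.
  by apply: (bessel_mirabolic psi_char besselL besselR _ xu Jx); rewrite /n; lia.
rewrite -[l (rho _ v0)]/(J _) bessel_unip ?emb_unip // whit'_unip //.
rewrite -diagmat_emb supdiag_block; last by move=> i j _; rewrite mxE.
by rewrite supdiag1 addr0 mulrC charN.
Qed.

Lemma dual_zeta_form_bessel :
  dual_zeta_form (rho (invmx (swapmx F m k)) v0) v0' = #|[set u : 'M[F]_m | unip u]|%:R.
Proof.
have su := swapmx_unit F m k.
have bJ x (y : 'M[F]_(m, k)) : x \in unitmx ->
    l (rho (bigmat x y) (rho (invmx (swapmx F m k)) v0)) = J (lowmat x y).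
  by move=> xu; rewrite -repM ?bigmat_unit ?unitmx_inv // bigmat_low mulmxK.
(* The support statement concerns the last row, so it is applied to [J] composed with [antitr],
   which has the same equivariance on both sides. *)
have J0 x (y : 'M[F]_(m, k)) : x \in unitmx -> ~~ (unip x && (y == 0)) -> J (lowmat x y) = 0.
  move=> xu; rewrite -lowmat_unip => nun; apply/eqP; apply: contraNT nun => Jx.
  rewrite -[lowmat x y]antitrK; apply: antitr_unip.
  apply: (@bessel_lastrow _ _ psi n (m + k) (J \o @antitr F n)) => //.
  - move=> u g uu gu /=; rewrite antitrM besselR ?antitr_unip ?antitr_unit //.
    by rewrite supdiag_antitr.
  - move=> u g uu gu /=; rewrite antitrM besselL ?antitr_unip ?antitr_unit //.
    by rewrite supdiag_antitr.
  - by rewrite /n addnS.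
  - by rewrite antitr_unit // lowmat_unit.
  - exact: lowmat_lastrow.
  by rewrite /= antitrK.
apply: sum_unip => [x xu nx|x xu].
  by rewrite big1 // => y _; rewrite bJ // J0 ?mul0r // (negbTE nx).
rewrite (bigD1 0) //= big1 ?addr0 => [|y y0]; last first.
  by rewrite bJ ?unip_unit // J0 ?mul0r ?unip_unit // (negbTE y0) andbF.
rewrite bJ ?unip_unit // bessel_unip ?lowmat_unip ?xu ?eqxx // whit'_unip //.
by rewrite supdiag_low mulrC charN.
Qed.

End ZetaIntegrals.

(** * The character attached to a root of unity *)

Lemma psiA_char (p : nat) (F : finFieldType) (A : comUnitRingType) (zeta : A)
    (lam : F -> 'F_p) :
  prime p -> p \in [pchar F] -> (p%:R : A) \is a GRing.unit ->
  \sum_(i < p) zeta ^+ i = 0 -> (forall x y, lam (x + y) = lam x + lam y) ->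
  (exists x, lam x != 0) -> additive_char (psiA zeta lam).
Proof.
move=> pp pF pu z0 lamD [x0 x0n].
have zp : zeta ^+ p = 1.
  apply/eqP; rewrite -subr_eq0 -[X in _ - X](expr1n _ p) subrXX.
  rewrite (eq_bigr (fun i : 'I_p => zeta ^+ (p.-1 - i))) => [|i _]; last first.
    by rewrite expr1n mulr1 -subn1 -subnDA add1n.
  rewrite (reindex_inj rev_ord_inj) /= (eq_bigr (fun i : 'I_p => zeta ^+ i)) ?z0 ?mulr0 // => i _.
  by congr (_ ^+ _); have := ltn_ord i; lia.
have lam0 : lam 0 = 0 by apply: (addrI (lam 0)); rewrite -lamD !addr0.
split.
- move=> x y; have zq : zeta ^+ (Zp_trunc (pdiv p)).+2 = 1 by rewrite Fp_cast.
  by rewrite /psiA lamD -exprD /= expr_mod.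
- by rewrite /psiA lam0.
(* This multiple of [x0] has [lam] equal to 1, so [psiA] takes the value [zeta] there. *)
- pose j := nat_of_ord ((lam x0)^-1); exists (x0 *+ j).
  have -> : psiA zeta lam (x0 *+ j) = zeta.
    have lamMn i : lam (x0 *+ i) = lam x0 *+ i.
      by elim: i => [|i IH]; rewrite ?mulr0n // !mulrS lamD IH.
    rewrite /psiA lamMn -mulr_natr natr_Zp mulfV //.
  (* The sum of all [1 - zeta ^+ i] is p, since the powers of [zeta] sum to 0; each term is
     divisible by [1 - zeta], which therefore divides the unit p. *)
  have e : (1 - zeta) * \sum_(i < p) \sum_(j < i) zeta ^+ j = p%:R.
    rewrite mulr_sumr (eq_bigr (fun i : 'I_p => 1 - zeta ^+ i)) => [|i _].
      by rewrite sumrB z0 subr0 sumr_const card_ord.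
    rewrite -[X in X - zeta ^+ i](expr1n _ i) subrXX; congr (_ * _).
    by apply: eq_bigr => h _; rewrite expr1n mul1r.
  by move: pu; rewrite -e unitrM => /andP[].
have := card_pprimeChar pF => ->.
by rewrite natrX unitrX.
Qed.

(** * The functional equation *)

Theorem theoremA (p : nat) (F : finFieldType) (A : comUnitRingType)
  (zeta : A) (lam : F -> 'F_p) (m k : nat)
  (V V' : lmodType A)
  (rho : 'M[F]_(m + k.+1) -> V -> V) (rho' : 'M[F]_m -> V' -> V') :
  prime p -> p \in [pchar F] ->
  (* A is a Z[1/p, zeta_p]-algebra, zeta the image of zeta_p *)
  (p%:R : A) \is a GRing.unit -> \sum_(i < p) zeta ^+ i = 0 ->
  (* psi : F -> Z[1/p,zeta_p]^x nontrivial, psi(x) = zeta_p ^ lam(x) *)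
  (forall x y, lam (x + y) = lam x + lam y) -> (exists x, lam x != 0) ->
  noetherian A -> (0 < m)%N ->
  is_rep rho -> is_rep rho' ->
  whittaker_type rho (psiA zeta lam) ->
  whittaker_type rho' (fun x => psiA zeta lam (- x)) ->
  ~ exceptional rho rho' (psiA zeta lam) (fun x => psiA zeta lam (- x)) ->
  exists! gamma : A, gamma \is a GRing.unit /\
    forall (W : 'M[F]_(m + k.+1) -> A) (W' : 'M[F]_m -> A),
      whittaker_model rho (psiA zeta lam) W ->
      whittaker_model rho' (fun x => psiA zeta lam (- x)) W' ->
      (\sum_(x in cosetreps F m) W (diagmat k x) * W' x) * gamma
      = \sum_(x in cosetreps F m) \sum_(y : 'M[F]_(m, k))
          W (bigmat x y) * W' x.
Proof.
move=> pp pF pu z0 lamD lamn _ m0 rho_rep rho'_rep [l l_gen] [l' l'_gen] nexc.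
have psi_char := psiA_char pp pF pu z0 lamD lamn.
move: (psiA zeta lam) psi_char l_gen l'_gen nexc => psi psi_char l_gen l'_gen nexc.
have psi'_char := char_neg psi_char.
have [v0 [l_v0 v0_unip]] := bessel_vector psi_char rho_rep l_gen.
have [v0' [l'_v0' _]] := bessel_vector psi'_char rho'_rep l'_gen.
have lt_mn : (m < m + k.+1)%N by lia.
pose N : A := #|[set u : 'M[F]_m | unip u]|%:R.
have Nu : N \is a GRing.unit := card_unip_unit psi_char m.
pose Z := zeta_form rho rho' l l'; pose D := dual_zeta_form (k := k) rho rho' l l'.
have ZN : Z v0 v0' = N.
  exact: (zeta_form_bessel psi_char rho_rep l_gen l'_gen l_v0 l'_v0' v0_unip).
have [w DN] : exists w, D w v0' = N.
  by eexists; apply: (dual_zeta_form_bessel psi_char rho_rep l_gen l'_gen l_v0 l'_v0' v0_unip).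
have Zcos v v' : Z v v' = N * \sum_(x in cosetreps F m) l (rho (diagmat k x) v) * l' (rho' x v').
  rewrite /Z /zeta_form sum_cosetreps => [|u x uu xu].
    by congr (_ * _); apply: eq_bigr => x _; rewrite diagmat_emb.
  rewrite embM ?leq_addr // repM ?emb_unit ?leq_addr // ?unip_unit // repM // ?unip_unit //.
  rewrite (whit_unip l_gen) ?emb_unip ?leq_addr // (whit_unip l'_gen) // mulrACA.
  rewrite -diagmat_emb supdiag_block; last by move=> i j _; rewrite mxE.
  by rewrite supdiag1 addr0 [psi _ * _]mulrC charN // mul1r.
have Dcos v v' : D v v' = N * \sum_(x in cosetreps F m) \sum_(y : 'M[F]_(m, k))
    l (rho (bigmat x y) v) * l' (rho' x v').
  rewrite /D /dual_zeta_form sum_cosetreps // => u x uu xu.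
  (* Replacing [x] by [u *m x] is a left translation of [bigmat] only if [y] becomes [u *m y] as
     well, hence this reindexing of the inner sum. *)
  have injh : injective (mulmx u : 'M[F]_(m, k) -> 'M[F]_(m, k)).
    by move=> y1 y2 e; rewrite -(mulKmx (unip_unit uu) y1) e mulKmx ?unip_unit.
  rewrite (reindex_inj injh); apply: eq_bigr => y _ /=.
  pose c : 'M[F]_(m + k.+1) := castmx (bigmat_eqr m k, bigmat_eqr m k) (block_mx 1%:M 0 0 u).
  have -> : bigmat (u *m x) (u *m y) = c *m bigmat x y.
    rewrite !bigmat_block -castM mulmx_block; congr (castmx _ _).
    rewrite !mulmx0 !mul0mx ?mulmx1 ?mul1mx ?addr0 ?add0r.
    congr (block_mx _ _ _ _).
    by rewrite (mul_mx_row u (0 : 'M_(m, 1)) y) mulmx0.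
  have cu : unip c by rewrite unip_cast unip_block unip1 uu eqxx.
  rewrite repM ?bigmat_unit // ?unip_unit // repM // ?unip_unit //.
  rewrite (whit_unip l_gen) // (whit_unip l'_gen) // mulrACA.
  rewrite supdiag_cast supdiag_block; last by move=> i j _; rewrite mxE.
  by rewrite supdiag1 add0r [psi _ * _]mulrC charN // mul1r.
(* Forced by evaluating [D = gamma * Z] at the Bessel pair, where [Z] equals the unit [N]. *)
pose gamma := N^-1 * D v0 v0'.
have DZ v v' : D v v' = gamma * Z v v'.
  apply/eqP; rewrite -subr_eq0; apply/eqP; move: v v'.
  apply: (stage_eq0 psi_char rho_rep rho'_rep l_gen l'_gen lt_mn nexc l_v0 l'_v0' v0_unip
    (leqnn m)).
    apply: stage_subZ; first exact: dual_zeta_form_stage.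
    exact: zeta_form_stage.
  by rewrite ZN mulrAC mulVr // mul1r subrr.
exists gamma; split; first split.
(* At the translated Bessel vector [w] the dual form is the unit [N], so its factor [gamma] is a
   unit. *)
- have : gamma * Z w v0' \is a GRing.unit by rewrite -DZ DN.
  by rewrite unitrM => /andP[].
- move=> W W' [l1 [l1g [v Wv]]] [l2 [l2g [v' Wv']]].
  have repsu x : x \in cosetreps F m -> x \in unitmx.
    have partP := equivalence_partitionP (@Nrel_equivalence F m).
    move=> xX; have := transversal_sub (transversalP partP).
    by move=> /subsetP/(_ x xX); rewrite inE.
  have WE g : g \in unitmx -> W g = l1 v0 * l (rho g v).
    by move=> gu; rewrite Wv // (whit_gen_proportional _ l_gen l1g l_v0).
  have W'E x : x \in unitmx -> W' x = l2 v0' * l' (rho' x v').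
    by move=> xu; rewrite Wv' // (whit_gen_proportional _ l'_gen l2g l'_v0').
  transitivity (l1 v0 * l2 v0' * (N^-1 * D v v')).
    rewrite DZ Zcos (mulrCA N^-1) mulKr // [RHS]mulrCA [LHS]mulrC; congr (_ * _).
    rewrite mulr_sumr; apply: eq_bigr => x /repsu xu.
    by rewrite W'E // WE ?diagmat_emb ?emb_unit ?leq_addr // mulrACA.
  rewrite Dcos mulKr // mulr_sumr; apply: eq_bigr => x /repsu xu.
  rewrite mulr_sumr; apply: eq_bigr => y _.
  by rewrite W'E // WE ?bigmat_unit // mulrACA.
(* Uniqueness: at the Bessel pair the coset sum on the left is 1, so the equation itself gives
   [gamma']. *)
move=> gamma' [_ H].
have := H (fun g => l (rho g v0)) (fun x => l' (rho' x v0')).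
have -> : \sum_(x in cosetreps F m) l (rho (diagmat k x) v0) * l' (rho' x v0') = 1.
  by apply: (mulrI Nu); rewrite -Zcos ZN mulr1.
rewrite mul1r => ->; first by rewrite /gamma Dcos mulKr.
- by exists l; split=> //; exists v0.
by exists l'; split=> //; exists v0'.
Qed.
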